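(* Let $g$ be a totally positive function of Gaussian type, and let $\Lambda \subseteq \mathbb{R}$ be a set with lower Beurling density $D^{-}(\Lambda) > 2$. Assume that $f_1, f_2 \in V^\infty(g)$ are real-valued and that $|f_1(\lambda)| = |f_2(\lambda)|$ for all $\lambda \in \Lambda$. Then either $f_1 \equiv f_2$ or $f_1 \equiv -f_2$ on $\mathbb{R}$.
   Context: A totally positive function of Gaussian type is a function $g \in L^2(\mathbb{R})$ whose Fourier transform factors as $$\hat g(\xi) = \int_{\mathbb{R}} g(x) e^{-2\pi i x \xi}\,dx = C_0 e^{-\gamma \xi^2} \prod_{\nu=1}^m (1+2\pi i \delta_\nu \xi)^{-1}, \qquad \xi \in \mathbb{R},$$ with $\delta_1,\ldots,\delta_m \in \mathbb{R}$, $C_0,\gamma > 0$, $m \in \mathbb{N}\cup\{0\}$ (the empty product for $m=0$ equals $1$). As usual, $g$ is identified with its continuous representative. The shift-invariant space generated by $g$ within $L^\infty(\mathbb{R})$ is $$V^\infty(g) = \Big\{ f = \sum_{k\in\mathbb{Z}} c_k\, g(\cdot - k) : c \in \ell^\infty(\mathbb{Z}) \Big\},$$ where the coefficients $c_k$ may be complex. Each $f \in V^\infty(g)$ is continuous (so point values make sense), the defining series converges unconditionally in the weak$^*$ topology of $L^\infty(\mathbb{R})$, and the coefficients $c_k$ are uniquely determined by $f$. The lower Beurling density of a set $\Lambda \subseteq \mathbb{R}$ is $$D^{-}(\Lambda) = \liminf_{r\to\infty} \inf_{x\in\mathbb{R}} \frac{\#\big(\Lambda \cap [x-r,x+r]\big)}{2r}.$$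 The set $\Lambda$ is not assumed to be separated or relatively separated. *)

(* Defs.v *)
From HB Require Import structures.
From mathcomp Require Import all_boot all_order all_algebra.
From mathcomp Require Import finmap.
From mathcomp Require Import all_classical all_reals all_analysis.
From mathcomp Require Import complex.
From mathcomp.analysis.showcase Require summability.

Set Implicit Arguments.
Unset Strict Implicit.
Unset Printing Implicit Defensive.
Import Order.TTheory GRing.Theory Num.Theory.
Import ComplexField.Normc.
Import numFieldNormedType.Exports.

Local Open Scope classical_set_scope.
Local Open Scope ring_scope.
Local Open Scope complex_scope.

(* The library puts no sigma-algebra on R[i]: measurability and integration of
   complex-valued functions are componentwise. *)
Definition complex_Lp (R : realType) (p : \bar R) (f : R -> R[i]) : Prop :=
  [/\ measurable_fun [set: R] (fun x => complex.Re (f x)),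
      measurable_fun [set: R] (fun x => complex.Im (f x)) &
      finite_norm (@lebesgue_measure R) p (fun x => normc (f x))].

Definition complex_integral (R : realType) (f : R -> R[i]) : R[i] :=
  (\int[@lebesgue_measure R]_x complex.Re (f x)) +i*
  (\int[@lebesgue_measure R]_x complex.Im (f x)).

Definition expi (R : realType) (t : R) : R[i] := cos t +i* sin t.

(* Meaningful for f in L^1: the integrals default to a junk value otherwise. *)
Definition fourier (R : realType) (f : R -> R[i]) (xi : R) : R[i] :=
  complex_integral (fun x => f x * expi (- (2 * pi * x * xi))).

(* Any g in L^2 whose transform is the function below is, up to a null set,
   continuous and integrable, so the last two conditions only select the
   continuous representative and make the Fourier integral absolutely
   convergent.  The parameters delta may vanish or coincide. *)
Definition gaussian_type_tp (R : realType) (g : R -> R[i]) : Prop :=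
  [/\ complex_Lp 2%:E g,
      (exists (C0 gamma : R) (m : nat) (delta : 'I_m -> R),
        [/\ 0 < C0, 0 < gamma &
          forall xi : R, fourier g xi =
            (C0 * expR (- (gamma * xi ^+ 2)))%:C *
            \prod_(nu < m) (1 + 'i * (2 * pi * delta nu * xi)%:C)^-1]),
      complex_Lp 1%:E g &
      continuous (g : R -> R[i]^o)].

(* Weak* convergence in L^oo(R), the dual of L^1(R). *)
Definition weak_star_cvg (R : realType) (I : Type) (F : set_system I)
    (u : I -> R -> R[i]) (f : R -> R[i]) : Prop :=
  forall h : R -> R[i], complex_Lp 1%:E h ->
    (fun i => complex_integral (fun x => u i x * h x) : R[i]^o) @ F -->
    (complex_integral (fun x => f x * h x) : R[i]^o).

(* Unconditional convergence is convergence along the net of finite sets of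
   indices; f is the continuous representative of its class. *)
Definition shift_invariant_Loo (R : realType) (g f : R -> R[i]) : Prop :=
  [/\ continuous (f : R -> R[i]^o), complex_Lp +oo%E f &
    exists c : int -> R[i],
      (exists M : R, forall k : int, normc (c k) <= M) /\
      weak_star_cvg summability.totally
        (fun (A : {fset int}) (x : R) => \sum_(k <- A) c k * g (x - k%:~R)) f].

Definition lower_beurling_density (R : realType) (L : set R) : \bar R :=
  limf_einf
    (fun r : R => ereal_inf
      (range (fun x : R =>
        (counting (L `&` `[(x - r)%R, (x + r)%R]) * (2 * r)^-1%:E)%E)))
    (pinfty_nbhs R).

(* Main.v *)
Require Import Defs.
From mathcomp Require Import all_boot all_order all_algebra.
From mathcomp Require Import finmap.
From mathcomp Require Import all_classical all_reals all_analysis.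
From mathcomp Require Import complex.
From mathcomp Require Import measurable_realfun ring lra.
From mathcomp.analysis.showcase Require summability.

(** The idea is to count zeros.  Since |f1| = |f2| on L and both functions are
    real, every point of L is a zero of f1 + f2 or of f1 - f2.  If neither of
    these functions vanishes identically, their zeros together are too sparse
    to cover a set of lower density larger than 2: each of them has, on average,
    at most one zero per unit length.

    For a Gaussian generator exp (- al x^2) this average bound is a form of
    Jensen's formula.  A function f(x) = sum_k c_k exp (- al (x - k)^2) with
    bounded coefficients equals exp (- al x^2) P(z), where z = exp (2 al x) and
    P is the Laurent series with coefficients a_k = c_k exp (- al k^2).  Zeros
    of f are positive zeros of P.  On the circles |z| = exp (+- 2 al r) the
    coefficients satisfy |a_k| |z|^k <= M exp (al r^2), because
    k^2 -+ 2 r k >= - r^2.  Dividing P by its zeros and comparing the circles of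
    radius S, 1 and 1/S gives sum (r - |l|) <= r^2 + O(r), the sum running over
    the zeros l in [-r, r] (gauss_zeros_sum).  The argument is elementary:
    the size of P on a circle is replaced by the supremum of its weighted
    coefficients, for which the three circles inequality is trivial and a factor
    z - x is removed by solving a difference equation (laurent_jensen).

    A general generator reduces to the Gaussian one by convolutions.  The factor
    (1 + 2 pi i delta xi)^-1 of the transform is the averaging operator
    E u (x) = int_0^oo exp (- s) u (x - delta s) ds, which inverts
    u + delta u'.  Hence f1 +- f2 is a finite iterate of such averages applied
    to a lattice sum of Gaussians.  By Rolle's theorem for exp (x / delta) E u,
    the function u has a zero between any two zeros of E u (exp_conv_rolle), so
    passing to the Gaussian level loses at most one zero per factor and interval,
    and density is unaffected.  If the Gaussian lattice sum is zero, so is f1 +- f2.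

    Two identifications remain.  First, g itself is the iterated average of a
    Gaussian (gaussian_type_tp_exp_convs): both have the same Fourier transform,
    and a continuous integrable function with vanishing transform is zero because
    its Poisson integrals vanish (trigT_unique).  Secondly, the weak* limit f of
    the partial sums is also their pointwise limit
    (shift_invariant_lattice_cvg), by dominated convergence against indicators
    of intervals. *)

Set Implicit Arguments.
Unset Strict Implicit.
Unset Printing Implicit Defensive.
Import Order.TTheory GRing.Theory Num.Theory.
Import numFieldNormedType.Exports.
Local Open Scope classical_set_scope.
Local Open Scope ring_scope.

(** * A Jensen inequality for Laurent series *)

Section Laurent.
Variable R : realType.
Implicit Types (a b q : int -> R) (x S B : R) (xs : seq R).

(** Decrease faster than any exponential at both ends: the Laurent series with
    these coefficients converges on the whole punctured plane. *)
Definition rapid a := forall S, 1 <= S ->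
  exists B, forall k, `|a k| * S ^+ `|k|%N <= B.

(** Coefficient form of sum a_k z^k = (z - x) sum b_k z^k. *)
Definition deflates x a b := forall k, a k = b (k - 1) - x * b k.

(** Vanishing at x is encoded as divisibility by z - x: this makes the removal
    of several roots purely algebraic.  The link with the value of the series is
    bisum0_laurent_root. *)
Definition laurent_root a x := exists2 b, rapid b & deflates x a b.

(** A substitute for the maximum of the series on the circle of radius S. *)
Definition coef_bound a S B := forall k, `|a k| * S ^ k <= B.

Lemma rapid_coef_bound a S : 0 < S -> rapid a -> exists B, coef_bound a S B.
Proof.
move=> S0 ra; have : 1 <= Num.max S S^-1.
  rewrite le_max; case: (leP 1 S) => //= S1.
  by rewrite invf_ge1// ltW.
move=> /ra[B aB]; exists B => k; apply: le_trans (aB k).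
rewrite ler_wpM2l//; case: k => n /=.
  by rewrite -exprnP lerXn2r ?nnegrE ?le_max ?(ltW S0)// lexx.
rewrite NegzE -exprnN -exprVn lerXn2r ?nnegrE ?le_max ?invr_ge0 ?(ltW S0) ?orbT//.
by rewrite lexx orbT.
Qed.

(** Take the supremum of beta on both sides; boundedness is needed to subtract
    half of it. *)
Lemma contraction_bound (T : Type) (phi : T -> T) (beta : T -> R) C :
  (exists N, forall t, beta t <= N) ->
  (forall t, beta t <= C + beta (phi t) / 2) -> forall t, beta t <= 2 * C.
Proof.
move=> [N bN] hb t0.
have hs : has_sup (range beta).
  by split; [exists (beta t0), t0 | exists N => _ [t _ <-]].
have ub t : beta t <= sup (range beta) by apply: sup_upper_bound => //; exists t.
have : sup (range beta) <= C + sup (range beta) / 2.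
  apply: ge_sup; first exact: hs.1.
  move=> _ [t _ <-]; apply: le_trans (hb t) _.
  by rewrite lerD2l ler_pM2r ?invr_gt0.
by move: (ub t0); lra.
Qed.

(** On the circle |z| = S one has |z - x| >= S - x >= S / 2, so a division by
    z - x costs the factor 2 / S. *)
Lemma deflates_outer x a b S B : 0 < x -> x *+ 2 <= S -> rapid b ->
  deflates x a b -> coef_bound a S B -> coef_bound b S (2 / S * B).
Proof.
move=> x0 xS rb ab aB k; have S0 : 0 < S by rewrite (lt_le_trans _ xS)// pmulrn_lgt0.
have [N bN] := rapid_coef_bound S0 rb.
rewrite -mulrA.
apply: (@contraction_bound _ (fun k => k + 1) (fun k => `|b k| * S ^ k) (S^-1 * B)).
  by exists N.
move=> {}k; have E : b k = a (k + 1) + x * b (k + 1) by rewrite ab addrK subrK.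
have -> : S ^ k = S^-1 * S ^ (k + 1).
  by rewrite expfzDr ?gt_eqF// expr1z mulrCA mulVf ?gt_eqF// mulr1.
rewrite E; apply: (@le_trans _ _ ((`|a (k + 1)| + x * `|b (k + 1)|) * (S^-1 * S ^ (k + 1)))).
  rewrite ler_wpM2r// ?mulr_ge0 ?invr_ge0 ?exprz_ge0 ?(ltW S0)//.
  by rewrite (le_trans (ler_normD _ _))// normrM (gtr0_norm x0).
have H := aB (k + 1).
have H2 : S^-1 * (`|a (k + 1)| * S ^ (k + 1)) <= S^-1 * B.
  by rewrite ler_pM2l ?invr_gt0.
set P := `|b (k+1)| * (S ^ (k + 1)).
have P0 : 0 <= P by rewrite mulr_ge0 ?exprz_ge0 ?(ltW S0).
have : S^-1 * x * P <= P / 2.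
  rewrite mulrC; apply: ler_wpM2l => //.
  by rewrite mulrC ler_pdivrMr// mulrC ler_pdivlMr// mulr_natr.
by rewrite /P; lra.
Qed.

(** On the circle |z| = S one has |z - x| >= x - S >= x / 2. *)
Lemma deflates_inner x a b S B : 0 < S -> S *+ 2 <= x -> rapid b ->
  deflates x a b -> coef_bound a S B -> coef_bound b S (2 / x * B).
Proof.
move=> S0 xS rb ab aB k; have x0 : 0 < x by rewrite (lt_le_trans _ xS)// pmulrn_lgt0.
have [N bN] := rapid_coef_bound S0 rb.
rewrite -mulrA.
apply: (@contraction_bound _ (fun k => k - 1) (fun k => `|b k| * S ^ k) (x^-1 * B)).
  by exists N.
move=> {}k; have E : b k = x^-1 * (b (k - 1) - a k).
  by rewrite ab opprB addrCA subrr addr0 mulrA mulVf ?mul1r ?gt_eqF.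
set P := `|b (k - 1)| * S ^ (k - 1).
have P0 : 0 <= P by rewrite mulr_ge0 ?exprz_ge0 ?(ltW S0).
have PE : `|b (k - 1)| * S ^ k = S * P.
  by rewrite /P mulrCA -{2}(expr1z S) -expfzDr ?gt_eqF// subrKC.
rewrite E; apply: (@le_trans _ _ (x^-1 * (`|b (k - 1)| + `|a k|) * S ^ k)).
  rewrite ler_wpM2r ?exprz_ge0 ?(ltW S0)//.
  by rewrite normrM gtr0_norm ?invr_gt0// ler_pM2l ?invr_gt0// ler_normB.
rewrite -mulrA mulrDl PE mulrDr addrC lerD//.
  by rewrite ler_pM2l ?invr_gt0.
rewrite mulrA mulrC ler_wpM2l//.
by rewrite mulrC ler_pdivrMr// mulrC ler_pdivlMr// mulr_natr.
Qed.

(** On the unit circle |z - x| <= 1 + x. *)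
Lemma deflates_unit x a b B : 0 < x ->
  deflates x a b -> coef_bound b 1 B -> coef_bound a 1 ((1 + x) * B).
Proof.
move=> x0 ab bB k; move: (bB k) (bB (k - 1)); rewrite !exp1rz !mulr1 => h1 h2.
rewrite ab (le_trans (ler_normB _ _))// mulrDl mul1r lerD//.
by rewrite normrM (gtr0_norm x0) ler_pM2l.
Qed.

(** Partial fractions: P / ((z - x) (z - y)) is the difference of P / (z - x) and
    P / (z - y), divided by x - y. *)
Lemma laurent_root_deflate x y a b : x != y -> rapid b -> deflates x a b ->
  laurent_root a y -> laurent_root b y.
Proof.
move=> xy rb ab [b' rb' ab'].
have xy0 : x - y != 0 by rewrite subr_eq0.
exists (fun k => (b k - b' k) / (x - y)) => [S S1|k].
  have [B bB] := rb _ S1; have [B' bB'] := rb' _ S1.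
  exists ((B + B') / `|x - y|) => k.
  rewrite normrM normfV mulrAC ler_pM2r ?invr_gt0 ?normr_gt0//.
  apply: le_trans (lerD (bB k) (bB' k)).
  by rewrite -mulrDl ler_wpM2r ?exprn_ge0 ?(le_trans _ S1)// ler_normB.
have := ab' k; rewrite ab => h.
apply: (mulIf xy0); rewrite mulrBl mulfVK// mulrA divfK//.
have -> : b' (k - 1) = b (k - 1) - x * b k + y * b' k by rewrite h subrK.
ring.
Qed.

(** Divide by the roots one after the other, keeping track of what each division
    costs on an outer circle, on an inner circle and on the unit circle. *)
Lemma laurent_quotient xs a : rapid a -> uniq xs ->
  (forall x, x \in xs -> 0 < x /\ laurent_root a x) ->
  exists2 q, rapid q &
  [/\ (forall S B, 0 < S -> (forall x, x \in xs -> x *+ 2 <= S) -> coef_bound a S B ->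
        coef_bound q S ((2 / S) ^+ size xs * B)),
      (forall S B, 0 < S -> (forall x, x \in xs -> S *+ 2 <= x) -> coef_bound a S B ->
        coef_bound q S ((\prod_(x <- xs) (2 / x)) * B)) &
      (forall B, coef_bound q 1 B -> coef_bound a 1 ((\prod_(x <- xs) (1 + x)) * B))].
Proof.
elim: xs a => [|x xs IH] a ra /=.
  move=> _ _; exists a => //; split => [S B _ _|S B _ _|B].
  - by rewrite expr0 mul1r.
  - by rewrite big_nil mul1r.
  - by rewrite big_nil mul1r.
move=> /andP[xxs uxs] h; have [x0 [b rb ab]] := h x (mem_head _ _).
have [|q rq [q1 q2 q3]] := IH b rb uxs.
  move=> y yxs; have [|y0 ry] := h y; first by rewrite inE yxs orbT.
  split=> //; apply: (laurent_root_deflate _ rb ab ry).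
  by apply: contraNneq xxs => ->.
exists q => //; split => [S B S0 hS aB|S B S0 hS aB|B qB].
- rewrite exprSr -mulrA; apply: q1 => // [y yxs|]; first by rewrite hS// inE yxs orbT.
  by apply: (deflates_outer _ _ _ ab) => //; rewrite hS// mem_head.
- rewrite big_cons [2 / x * _]mulrC -mulrA.
  apply: q2 => // [y yxs|]; first by rewrite hS// inE yxs orbT.
  by apply: (deflates_inner _ _ _ ab) => //; rewrite hS// mem_head.
- by rewrite big_cons -mulrA; apply: deflates_unit ab _ => //; exact: q3.
Qed.

(** Let q be the quotient by the roots xs.  Since |q_k|^2 is the product of
    |q_k| S^k and |q_k| S^-k, the size of q on the unit circle is at most the
    geometric mean of its sizes on the circles of radius S and S^-1; multiply the
    roots back on the unit circle.  Each root contributes, up to the constant 4,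
    the factor S / max (x, 1/x) of Jensen's formula for an annulus. *)
Lemma laurent_jensen a xs S B j : rapid a -> 0 < S -> uniq xs ->
  (forall x, x \in xs -> laurent_root a x) ->
  (forall x, x \in xs -> S^-1 *+ 2 <= x /\ x *+ 2 <= S) ->
  coef_bound a S B -> coef_bound a S^-1 B ->
  `|a j| ^+ 2 * \prod_(x <- xs) (S * x / (4 * (1 + x) ^+ 2)) <= B ^+ 2.
Proof.
move=> ra S0 uxs rt rg aB aB'.
have Si0 : 0 < S^-1 by rewrite invr_gt0.
have x0 x : x \in xs -> 0 < x.
  by move=> /rg[+ _]; apply: lt_le_trans; rewrite pmulrn_lgt0.
have [|q rq [q1 q2 q3]] := laurent_quotient ra uxs.
  by move=> x xxs; split; [exact: x0|exact: rt].
have h1 := q1 S B S0 (fun x xxs => (rg x xxs).2) aB.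
have h2 := q2 S^-1 B Si0 (fun x xxs => (rg x xxs).1) aB'.
set P1 := (2 / S) ^+ size xs in h1; set P2 := \prod_(x <- xs) (2 / x) in h2.
have P1E : P1 = \prod_(x <- xs) (2 / S) by rewrite /P1 big_const_seq count_predT iter_mulr_1.
have P10 : 0 < P1 by rewrite exprn_gt0// divr_gt0.
have P20 : 0 < P2.
  by rewrite /P2 big_seq prodr_gt0// => x /x0 x0'; rewrite divr_gt0.
have B0 : 0 <= B by rewrite (le_trans _ (aB 0))// mulr_ge0 ?exprz_ge0 ?(ltW S0).
have hq : coef_bound q 1 (Num.sqrt (P1 * P2) * B).
  move=> k; rewrite exp1rz mulr1.
  rewrite -(@ler_pXn2r _ 2) ?nnegrE ?mulr_ge0 ?sqrtr_ge0//.
  rewrite exprMn sqr_sqrtr ?mulr_ge0 ?(ltW P10) ?(ltW P20)//.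
  have -> : `|q k| ^+ 2 = (`|q k| * S ^ k) * (`|q k| * S^-1 ^ k).
    rewrite mulrACA -expr2 exprz_inv -expfzDr ?gt_eqF// subrr expr0z mulr1//.
  have -> : P1 * P2 * B ^+ 2 = (P1 * B) * (P2 * B) by ring.
  by rewrite ler_pM// ?mulr_ge0 ?exprz_ge0 ?(ltW S0) ?(ltW Si0).
have := q3 _ hq j; rewrite exp1rz mulr1.
set P3 := \prod_(x <- xs) (1 + x) => h3.
have P30 : 0 < P3.
  by rewrite /P3 big_seq prodr_gt0// => x /x0 x0'; rewrite addr_gt0.
have {}h3 : `|a j| ^+ 2 <= P3 ^+ 2 * (P1 * P2) * B ^+ 2.
  rewrite -(@sqr_sqrtr _ (P1 * P2)) ?mulr_ge0 ?(ltW P10) ?(ltW P20)//.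
  by rewrite -!exprMn lerXn2r ?nnegrE// ?mulr_ge0 ?sqrtr_ge0 ?(ltW P30)// -mulrA.
have -> : \prod_(x <- xs) (S * x / (4 * (1 + x) ^+ 2)) = (P3 ^+ 2 * (P1 * P2))^-1.
  rewrite /P3 /P2 P1E -prodrXl -!big_split/= -prodfV.
  rewrite big_seq [RHS]big_seq; apply: eq_bigr => x /x0 x0'.
  field; apply/and3P; split; apply: lt0r_neq0 => //; exact: addr_gt0.
have PP0 : 0 < P3 ^+ 2 * (P1 * P2).
  by apply: mulr_gt0; [exact: exprn_gt0|exact: mulr_gt0].
by rewrite ler_pdivrMr// mulrC.
Qed.

End Laurent.

(** * Zeros of Laurent series as divisors *)

Section Series.
Variable R : realType.
Implicit Types (a b c t : int -> R) (u : R^nat) (x r S B T : R).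

Lemma cvg_norm_le u l B : u @ \oo --> l -> (forall n, `|u n| <= B) -> `|l| <= B.
Proof.
move=> ul uB; have ul' : `|u n| @[n --> \oo] --> `|l| by apply: cvg_norm.
rewrite -(cvg_lim _ ul')//; apply: limr_le; first by apply/cvg_ex; exists `|l|.
by near=> n; exact: uB.
Unshelve. all: by end_near. Qed.

Lemma bounded_series_cvg u B : (forall n, \sum_(0 <= i < n) `|u i| <= B) ->
  cvgn (series u).
Proof.
move=> uB; apply: normed_cvg; apply: nondecreasing_is_cvgn.
  by apply: nondecreasing_series => i _ _; exact: normr_ge0.
by exists B => _ [n _ <-]; exact: uB.
Qed.

Lemma geometric_series_cvg u r B : 0 <= r <= 2^-1 ->
  (forall i, `|u i| <= B * r ^+ i) -> cvgn (series u).
Proof.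
move=> /andP[r0 r1] uB.
have B0 : 0 <= B by have := uB 0%N; rewrite expr0 mulr1; exact: le_trans.
apply: (@bounded_series_cvg _ (2 * B)) => n.
suff : \sum_(0 <= i < n) `|u i| <= 2 * B * (1 - r ^+ n).
  move=> /le_trans; apply; rewrite ler_piMr ?mulr_ge0//.
  by rewrite gerBl exprn_ge0.
elim: n => [|n IH]; first by rewrite big_nil expr0 subrr mulr0.
rewrite big_nat_recr//=; apply: le_trans (lerD IH (uB n)) _.
have rn : 0 <= B * r ^+ n by rewrite mulr_ge0 ?exprn_ge0.
have : B * r ^+ n * r <= B * r ^+ n * 2^-1 by rewrite ler_wpM2l.
rewrite exprSr; lra.
Qed.

(** The ratio at most 1/2 makes the tail at most twice its first term. *)
Lemma geometric_series_tail u r B T : 0 <= r <= 2^-1 ->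
  (forall i, `|u i| <= B * r ^+ i) -> series u @ \oo --> T ->
  forall n, `|T - series u n| <= 2 * (B * r ^+ n).
Proof.
move=> /andP[r0 r1] uB uT n.
have B0 : 0 <= B by have := uB 0%N; rewrite expr0 mulr1; exact: le_trans.
apply: (@cvg_norm_le (fun m => series u (m + n)%N - series u n)).
  by apply: cvgB; [rewrite cvg_shiftn|exact: cvg_cst].
move=> m; suff : `|series u (m + n)%N - series u n| <= 2 * (B * r ^+ n) * (1 - r ^+ m).
  move=> /le_trans; apply; rewrite ler_piMr ?mulr_ge0 ?exprn_ge0//.
  by rewrite gerBl exprn_ge0.
elim: m => [|m IH]; first by rewrite add0n subrr normr0 expr0 subrr mulr0.
have -> : series u (m.+1 + n)%N - series u n =
   series u (m + n)%N - series u n + u (m + n)%N.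
  by rewrite addSn {1}/series/= big_nat_recr//= addrAC.
apply: le_trans (ler_normD _ _) _; apply: le_trans (lerD IH (uB _)) _.
have rn : 0 <= B * r ^+ n * r ^+ m by rewrite !mulr_ge0 ?exprn_ge0.
have : B * r ^+ n * r ^+ m * r <= B * r ^+ n * r ^+ m * 2^-1 by rewrite ler_wpM2l.
rewrite exprD [r ^+ m.+1]exprSr; lra.
Qed.

(** Partial sums of a bilateral series over the indices -n, ..., n - 1: the
    constructor Negz i stands for - (i + 1). *)
Definition bipartial t : R^nat := series (fun n => t n%:Z + t (Negz n)).

Definition bisum t : R := limn (bipartial t).

Lemma bipartialE t n : bipartial t n =
  series (fun i => t i%:Z) n + series (fun i => t (Negz i)) n.
Proof. by rewrite /bipartial /series/= big_split. Qed.

(** The quotient by z - x has the coefficients x^(-k-1) sum_(i > k) a_i x^i.  As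
    the whole sum vanishes, these are also - x^(-k-1) sum_(i <= k) a_i x^i, so
    they decrease rapidly at both ends. *)
Lemma bisum0_laurent_root a x : 0 < x -> rapid a ->
  bipartial (fun k => a k * x ^ k) @ \oo --> 0 -> laurent_root a x.
Proof.
move=> x0 ra t0; set t := (fun k => a k * x ^ k) in t0.
pose tp i := t (Posz i); pose tn i := t (Negz i).
have xV0 : 0 < x^-1 by rewrite invr_gt0.
(* superexponential decay beats any geometric ratio r, on both halves *)
have geo r : 0 < r -> exists2 B : R, 0 <= B & (forall i, `|tp i| <= B * r ^+ i) /\
    (forall i, `|tn i| <= B * r ^+ i.+1).
  move=> r0; pose S := Num.max 1 (Num.max (x / r) (r * x)^-1).
  have S1 : 1 <= S by rewrite le_max lexx.
  have S0 : 0 < S by rewrite (lt_le_trans _ S1).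
  have Sxr : x / r <= S by rewrite !le_max lexx !orbT.
  have Srx : (r * x)^-1 <= S by rewrite !le_max lexx !orbT.
  have [B aB] := ra S S1.
  have B0 : 0 <= B by rewrite (le_trans _ (aB 0))// expr0 mulr1.
  have {}aB k : `|a k| <= B * S^-1 ^+ `|k|%N.
    by rewrite exprVn ler_pdivlMr ?exprn_gt0.
  have SV0 : 0 <= S^-1 by rewrite invr_ge0 ltW.
  exists B => //; split=> i.
    rewrite /tp /t normrM -exprnP (@ger0_norm _ (x ^+ i)) ?exprn_ge0 ?(ltW x0)//.
    apply: le_trans (ler_wpM2r _ (aB _)) _; first by rewrite exprn_ge0 ?(ltW x0).
    rewrite -mulrA -exprMn ler_wpM2l// lerXn2r ?nnegrE ?mulr_ge0 ?(ltW x0) ?(ltW r0)//.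
    by rewrite mulrC ler_pdivrMr// mulrC -ler_pdivrMr.
  rewrite /tn /t normrM NegzE -exprnN -exprVn.
  rewrite (@ger0_norm _ (x^-1 ^+ _)) ?exprn_ge0 ?(ltW xV0)//.
  apply: le_trans (ler_wpM2r _ (aB _)) _; first by rewrite exprn_ge0 ?(ltW xV0).
  rewrite -mulrA -exprMn ler_wpM2l// lerXn2r ?nnegrE ?mulr_ge0 ?(ltW xV0) ?(ltW r0)//.
  rewrite ler_pdivrMr// -[leRHS]invrK lef_pV2 ?posrE ?invr_gt0 ?mulr_gt0//.
have half : 0 <= (2^-1 : R) <= 2^-1 by rewrite lexx invr_ge0 ler0n.
have [|B0 B00 [tpB tnB]] := geo 2^-1; first by rewrite invr_gt0.
have cp : cvgn (series tp) by exact: geometric_series_cvg half tpB.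
have cn : cvgn (series tn).
  by apply: (@geometric_series_cvg _ 2^-1 (B0 / 2)) => // i; rewrite -mulrA -exprS.
pose Tp := limn (series tp); pose Tn := limn (series tn).
have TpTn : Tp + Tn = 0.
  apply: (@cvg_unique _ _ (bipartial t @ \oo)) => //; rewrite (_ : bipartial t = series tp \+ series tn).
    exact: cvgD.
  by apply/funext => n; rewrite bipartialE.
(* F k is the tail of t beyond k; on the negative side it is rewritten with
   Tp = - Tn, so that it is small at both ends *)
pose F (k : int) := match k with Posz n => Tp - series tp n.+1 | Negz n => Tp + series tn n end.
have FE k : F (k - 1) = F k + t k.
  case: k => [[|n]|n].
  - rewrite sub0r (_ : - 1 = Negz 0)//= /series/= big_nil addr0 big_nat1.
    by rewrite subrK.
  - have -> : Posz n.+1 - 1 = Posz n by rewrite -addn1 PoszD addrK.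
    by rewrite /F /series/= [in RHS]big_nat_recr//= opprD addrA subrK.
  - have -> : Negz n - 1 = Negz n.+1 by rewrite !NegzE -opprD -PoszD addn1.
    by rewrite /F /series/= big_nat_recr//= addrA.
exists (fun k => x ^ (- k - 1) * F k); last first.
  move=> k; rewrite FE (_ : - (k - 1) - 1 = - k); last by ring.
  have -> : x * (x ^ (- k - 1) * F k) = x ^ (- k) * F k.
    by rewrite mulrA -{1}(expr1z x) -expfzDr ?gt_eqF// subrKC.
  rewrite -mulrBr [F k + _]addrC addrK /t.
  by rewrite mulrC -mulrA -expfzDr ?gt_eqF// subrr expr0z mulr1.
move=> S S1; have S0 : 0 < S by rewrite (lt_le_trans _ S1).
(* small enough to beat both x^-1 and x, each times S *)
pose r := Num.min 2^-1 (Num.min (x / S) (S * x)^-1).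
have r0 : 0 < r by rewrite !lt_min divr_gt0// !invr_gt0 mulr_gt0 ?ltr0n.
have r2 : 0 <= r <= 2^-1 by rewrite (ltW r0) ge_min lexx.
have rS : r * S <= x by rewrite -ler_pdivlMr// !ge_min lexx !orbT.
have rSx : r * (S * x) <= 1 by rewrite -ler_pdivlMr ?mulr_gt0// mul1r !ge_min lexx !orbT.
have [B B1 [pB nB]] := geo r r0.
have tailp := geometric_series_tail r2 pB cp.
have tailn n : `|Tn - series tn n| <= 2 * (B * r * r ^+ n).
  by apply: (geometric_series_tail r2) cn _ => i; rewrite -mulrA -exprS.
exists (2 * B + 2 * B / x) => -[n|n].
  rewrite -[leLHS]addr0 lerD// ?divr_ge0 ?mulr_ge0 ?(ltW x0)//.
  rewrite normrM -opprD -PoszD addn1 -exprnN -exprVn ger0_norm ?exprn_ge0 ?(ltW xV0)//.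
  apply: (@le_trans _ _ (x^-1 ^+ n.+1 * (2 * (B * r ^+ n.+1)) * S ^+ n.+1)).
    apply: ler_pM; rewrite ?mulr_ge0 ?exprn_ge0 ?(ltW xV0) ?(ltW S0)//.
      by rewrite ler_wpM2l ?exprn_ge0 ?(ltW xV0)//; exact: tailp.
    by rewrite /= exprS ler_peMl ?exprn_ge0 ?(ltW S0).
  have -> : x^-1 ^+ n.+1 * (2 * (B * r ^+ n.+1)) * S ^+ n.+1 =
     2 * B * (x^-1 * (r * S)) ^+ n.+1 by rewrite !exprMn; ring.
  rewrite ler_piMr ?mulr_ge0// exprn_ile1// ?mulr_ge0 ?(ltW xV0) ?(ltW r0) ?(ltW S0)//.
  by rewrite mulrC ler_pdivrMr// mul1r.
rewrite -[leLHS]add0r lerD// ?mulr_ge0//.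
have -> : - Negz n - 1 = n by rewrite NegzE opprK -addn1 PoszD addrK.
rewrite normrM -exprnP ger0_norm ?exprn_ge0 ?(ltW x0)//.
have -> : F (Negz n) = - (Tn - series tn n).
  by rewrite /F opprB addrC; congr (_ + _); apply/eqP; rewrite -addr_eq0; apply/eqP.
rewrite normrN ler_pdivlMr//.
apply: (@le_trans _ _ (x ^+ n * (2 * (B * r * r ^+ n)) * S ^+ n.+1 * x)).
  by rewrite !ler_wpM2r ?exprn_ge0 ?(ltW x0) ?(ltW S0)// ler_wpM2l ?exprn_ge0 ?(ltW x0).
have -> : x ^+ n * (2 * (B * r * r ^+ n)) * S ^+ n.+1 * x = 2 * B * (r * (S * x)) ^+ n.+1.
  by rewrite !exprMn !exprS; ring.
by rewrite ler_piMr ?mulr_ge0// exprn_ile1// ?mulr_ge0 ?(ltW r0) ?(ltW S0) ?(ltW x0).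
Qed.
End Series.

(** * Lattice sums of rapidly decaying functions *)

Section Lattice.
Variable R : realType.
Implicit Types (c : int -> R) (t : R) (u h : R -> R) (x y B K M : R).

(** A weight comparable to 1 / (1 + x^2), chosen so that its sums over shifted
    integers telescope (decay_telescope). *)
Definition decay x : R := ((1 + `|x|) * (2 + `|x|))^-1.

Lemma decay_gt0 x : 0 < decay x.
Proof. by rewrite invr_gt0 mulr_gt0// ltr_pwDl. Qed.

Lemma decay_le1 x : decay x <= 1.
Proof.
rewrite invf_le1 ?mulr_gt0// ?ltr_pwDl//.
by have := normr_ge0 x; nra.
Qed.

Let Phi x : R := x / (1 + `|x|).

(** For x >= 0 this is an equality; otherwise the difference of the two sides is
    an explicit nonnegative fraction. *)
Lemma decay_telescope x : decay x <= Phi (x + 1) - Phi x.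
Proof.
rewrite /decay /Phi; have [x0|x0] := leP 0 x.
  rewrite !ger0_norm ?addr_ge0//.
  rewrite le_eqVlt; apply/orP; left; apply/eqP; field.
  by apply/andP; split; rewrite gt_eqF//; lra.
have [x1|x1] := leP 0 (x + 1).
  rewrite (ltr0_norm x0) (ger0_norm x1).
  have h1 : 0 < (1 - x) by lra.
  have h2 : 0 < 2 - x by lra.
  have h3 : 0 < 2 + x by lra.
  rewrite -subr_ge0.
  have -> : (x + 1) / (1 + (x + 1)) - x / (1 - x) - ((1 - x) * (2 - x))^-1 =
    (((x + 1) * (1 - x) - x * (2 + x)) * (2 - x) - (2 + x)) / ((2 + x) * (1 - x) * (2 - x)).
    by field; rewrite !gt_eqF//; lra.
  apply: divr_ge0; last by rewrite !mulr_ge0 ?ltW.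
  have -> : ((x + 1) * (1 - x) - x * (2 + x)) * (2 - x) - (2 + x) =
    (- x) * (2 * (3 + x - x ^+ 2)) by ring.
  apply: mulr_ge0; first by lra.
  have := mulr_ge0 x1 (ltW (_ : 0 < - x)); rewrite oppr_gt0 => /(_ x0).
  by rewrite expr2; lra.
rewrite (ltr0_norm x0) (ltr0_norm x1).
have h1 : 0 < (1 - x) by lra.
have h2 : 0 < 2 - x by lra.
have h3 : 0 < - x by lra.
rewrite -subr_ge0.
have -> : (x + 1) / (1 - (x + 1)) - x / (1 - x) - ((1 - x) * (2 - x))^-1 =
    2 / ((- x) * (1 - x) * (2 - x)).
  by field; rewrite (lt_eqF x0) !gt_eqF//; lra.
by rewrite divr_ge0// !mulr_ge0 ?ltW.
Qed.

Lemma Phi_norm_le1 x : `|Phi x| <= 1.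
Proof.
have x1 : 0 < 1 + `|x| by rewrite ltr_pwDl.
by rewrite /Phi normrM normfV (gtr0_norm x1) ler_pdivrMr// mul1r lerDr.
Qed.

(** The sum over 2n consecutive integer shifts telescopes to a difference of two
    values of Phi, hence the bound does not depend on x or n. *)
Lemma decay_lattice_sum x n :
  \sum_(0 <= i < n) (decay (x - (Posz i)%:~R) + decay (x - (Negz i)%:~R)) <= 2.
Proof.
suff : \sum_(0 <= i < n) (decay (x - (Posz i)%:~R) + decay (x - (Negz i)%:~R))
   <= Phi (x + 1 + n%:R) - Phi (x + 1 - n%:R).
  move=> /le_trans; apply.
  have := Phi_norm_le1 (x + 1 + n%:R); have := Phi_norm_le1 (x + 1 - n%:R).
  by rewrite !ler_norml; lra.
elim: n => [|n IH]; first by rewrite big_nil addr0 subr0 subrr.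
rewrite big_nat_recr//=.
have := decay_telescope (x - n%:R); have := decay_telescope (x + n.+1%:R).
rewrite NegzE mulrNz opprK -!pmulrn.
have -> : x + n.+1%:R + 1 = x + 1 + n.+1%:R by ring.
have -> : x - n%:R + 1 = x + 1 - n%:R by ring.
have -> : x + n.+1%:R = x + 1 + n%:R by rewrite -addn1 natrD; ring.
have -> : x - n%:R = x + 1 - n.+1%:R by rewrite -addn1 natrD; ring.
by move: IH; lra.
Qed.

Lemma lattice_sum_le c h M K x n : (forall k, `|c k| <= M) ->
  (forall x, `|h x| <= K * decay x) ->
  \sum_(0 <= i < n) `|c (Posz i) * h (x - (Posz i)%:~R) + c (Negz i) * h (x - (Negz i)%:~R)|
    <= M * K * 2.
Proof.
move=> cM hK.
have M0 : 0 <= M by rewrite (le_trans _ (cM 0)).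
have K0 : 0 <= K.
  by have := le_trans (normr_ge0 _) (hK 0); rewrite pmulr_lge0// decay_gt0.
apply: le_trans (ler_wpM2l _ (decay_lattice_sum x n)); last exact: mulr_ge0.
rewrite mulr_sumr; apply: ler_sum => i _.
apply: le_trans (ler_normD _ _) _; rewrite mulrDr !normrM -!mulrA.
by apply: lerD; apply: ler_pM.
Qed.

Definition lattice_sum c h x := bisum (fun k => c k * h (x - k%:~R)).
Definition lattice_partial c h n x := bipartial (fun k => c k * h (x - k%:~R)) n.

Section bounded.
Variables (c : int -> R) (h : R -> R) (M K : R).
Hypotheses (cM : forall k, `|c k| <= M) (hK : forall x, `|h x| <= K * decay x).

Lemma lattice_sum_cvg x : lattice_partial c h ^~ x @ \oo --> lattice_sum c h x.
Proof.
by apply: (@bounded_series_cvg _ _ (M * K * 2)) => n; apply: lattice_sum_le.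
Qed.

Lemma lattice_partial_bounded n x : `|lattice_partial c h n x| <= M * K * 2.
Proof.
by apply: le_trans (lattice_sum_le x n cM hK); rewrite ler_norm_sum.
Qed.

Lemma lattice_sum_bounded x : `|lattice_sum c h x| <= M * K * 2.
Proof.
apply: cvg_norm_le (@lattice_sum_cvg x) _ => n; exact: lattice_partial_bounded.
Qed.

(** The Lipschitz constants of the terms are summable uniformly in x; this gives
    continuity of the sum without any uniform convergence. *)
Lemma lattice_sum_lipschitz K' :
  (forall x y, `|x - y| <= 1 -> `|h x - h y| <= K' * decay x * `|x - y|) ->
  forall x y, `|x - y| <= 1 -> `|lattice_sum c h x - lattice_sum c h y| <= M * K' * 2 * `|x - y|.
Proof.
move=> hK' x y xy.
have K'0 : 0 <= K'.
  have /hK' : `|0 - 1 : R| <= 1 by rewrite sub0r normrN normr1.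
  rewrite sub0r normrN1 mulr1 => /(le_trans (normr_ge0 _)).
  by rewrite pmulr_lge0// decay_gt0.
have M0 : 0 <= M by rewrite (le_trans _ (cM 0)).
apply: (@cvg_norm_le _ (fun n => lattice_partial c h n x - lattice_partial c h n y)).
  by apply: cvgB; exact: lattice_sum_cvg.
move=> n; rewrite /lattice_partial /bipartial /series/= -sumrB.
apply: le_trans (ler_norm_sum _ _ _) _.
apply: (@le_trans _ _ (M * K' * `|x - y| * 2)); last by rewrite mulrAC.
apply: le_trans (ler_wpM2l _ (decay_lattice_sum x n)); last by rewrite !mulr_ge0.
rewrite mulr_sumr; apply: ler_sum => i _.
have E k : `|c k * h (x - k%:~R) - c k * h (y - k%:~R)| <=
   M * K' * `|x - y| * decay (x - k%:~R).
  rewrite -mulrBr normrM -!mulrA; apply: ler_pM => //.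
  have -> : K' * (`|x - y| * decay (x - k%:~R)) =
     K' * decay (x - k%:~R) * `|(x - k%:~R) - (y - k%:~R)|.
    by rewrite (_ : x - k%:~R - (y - k%:~R) = x - y); ring.
  by apply: hK'; rewrite (_ : x - k%:~R - (y - k%:~R) = x - y)//; ring.
rewrite mulrDr; apply: le_trans (lerD (E (Posz i)) (E (Negz i))).
by rewrite opprD addrACA; exact: ler_normD.
Qed.
End bounded.

Definition gauss al x : R := expR (- (al * x ^+ 2)).

(** Square 1 + t / 2 <= exp (t / 2). *)
Lemma expRN_sq_le t : 0 <= t -> expR (- t) <= 4 / (2 + t) ^+ 2.
Proof.
move=> t0; have h : 1 + t / 2 <= expR (t / 2) by apply: expR_ge1Dx.
have h0 : 0 < 2 + t by lra.
rewrite expRN -[leRHS]invrK lef_pV2 ?posrE ?expR_gt0 ?invr_gt0 ?divr_gt0 ?exprn_gt0//.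
have -> : expR t = expR (t / 2) ^+ 2 by rewrite -expRM_natl; congr expR; field.
have -> : (4 / (2 + t) ^+ 2)^-1 = (1 + t / 2) ^+ 2 by field; rewrite gt_eqF.
by rewrite lerXn2r ?nnegrE ?expR_ge0//; lra.
Qed.

Section gauss.
Variable al : R.
Hypothesis al0 : 0 < al.

Lemma gauss_decay : exists K, forall x, `|gauss al x| <= K * decay x.
Proof.
exists (8 * (1 + al^-1)) => x; rewrite /gauss /decay ger0_norm ?expR_ge0//.
have x0 := normr_ge0 x; set y := `|x| in x0 *.
have -> : x ^+ 2 = y ^+ 2 by rewrite /y real_normK// num_real.
rewrite ler_pdivlMr; last by nra.
have aV : 0 < al^-1 by rewrite invr_gt0.
have h : expR (- (al * y ^+ 2)) * (1 + al * y ^+ 2) <= 1.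
  rewrite expRN mulrC ler_pdivrMr ?expR_gt0// mul1r; apply: expR_ge1Dx.
have e0 : 0 < expR (- (al * y ^+ 2)) by exact: expR_gt0.
have : (1 + y) * (2 + y) <= 8 * (1 + al^-1) * (1 + al * y ^+ 2).
  have -> : 8 * (1 + al^-1) * (1 + al * y ^+ 2) =
     8 * (1 + al^-1 + al * y ^+ 2 + y ^+ 2) by field; rewrite gt_eqF.
  have := mulr_ge0 (ltW al0) (sqr_ge0 y); have := sqr_ge0 (y - 1); have := sqr_ge0 y.
  by lra.
move=> /(ler_wpM2l (ltW e0)) /le_trans; apply.
rewrite mulrCA ler_piMr//; lra.
Qed.

Lemma is_derive_gauss x : is_derive x 1 (gauss al) (gauss al x * - (2 * al * x)).
Proof.
apply: (@is_derive1_comp _ expR (fun x => - (al * x ^+ 2))).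
apply: is_derive_eq; rewrite !scaler1 /GRing.scale/=.
by ring.
Qed.

(** Mean value theorem, and exp (- al w^2) <= 4 / (2 + al w^2)^2 against the
    cubic growth of w (2 + w) (3 + w). *)
Lemma gauss_lipschitz : exists K, forall x y, `|x - y| <= 1 ->
  `|gauss al x - gauss al y| <= K * decay x * `|x - y|.
Proof.
exists (72 * al * (1 + al^-1) ^+ 2) => x y xy.
have al0' := ltW al0; have aV : 0 < al^-1 by rewrite invr_gt0.
have slope z : `|z - x| <= 1 ->
    `|gauss al z * - (2 * al * z)| <= 72 * al * (1 + al^-1) ^+ 2 * decay x.
  move=> zx; rewrite /decay ler_pdivlMr ?mulr_gt0 ?ltr_pwDl//.
  rewrite mulrN normrN normrM (gtr0_norm (expR_gt0 _)) !normrM (gtr0_norm al0) ger0_norm//.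
  have xz : `|x| <= `|z| + 1.
    rewrite -lerBlDl (le_trans _ zx)// distrC.
    exact: le_trans (ler_norm _) (ler_dist_dist _ _).
  rewrite /gauss -(real_normK (num_real z)).
  set w := `|z| in xz *; have w0 : 0 <= w by exact: normr_ge0.
  have x0 := normr_ge0 x.
  have := expRN_sq_le (mulr_ge0 al0' (sqr_ge0 w)).
  set e := expR _; have e0 : 0 <= e by exact: expR_ge0.
  have s0 : 0 < 2 + al * w ^+ 2 by rewrite ltr_pwDl// mulr_ge0// sqr_ge0.
  rewrite ler_pdivlMr ?exprn_gt0// => h.
  have p1 : (1 + `|x|) * (2 + `|x|) <= (2 + w) * (3 + w) by apply: ler_pM; lra.
  have p2 : w * ((2 + w) * (3 + w)) <= 9 * (1 + w ^+ 2) ^+ 2.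
    have := mulr_ge0 w0 (sqr_ge0 (w - 1)); have := sqr_ge0 (w - 1).
    have := sqr_ge0 (w ^+ 2); have := sqr_ge0 w; have := sqr_ge0 (w * (w - 1)).
    rewrite !expr2; lra.
  have p3 : (1 + w ^+ 2) ^+ 2 <= (1 + al^-1) ^+ 2 * (2 + al * w ^+ 2) ^+ 2.
    have w2 := sqr_ge0 w.
    have s1 := mulr_ge0 (addr_ge0 ler01 (ltW aV)) (ltW s0).
    rewrite -exprMn; apply: lerXn2r; rewrite ?nnegrE// ?addr_ge0//.
    have -> : (1 + al^-1) * (2 + al * w ^+ 2) = 2 + al * w ^+ 2 + 2 * al^-1 + w ^+ 2.
      by field; rewrite gt_eqF.
    by have := mulr_ge0 al0' w2; lra.
  have q1 : e * (2 * al * w) * ((1 + `|x|) * (2 + `|x|)) <= e * (2 * al) * (w * ((2 + w) * (3 + w))).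
    have -> : e * (2 * al) * (w * ((2 + w) * (3 + w))) = e * (2 * al * w) * ((2 + w) * (3 + w)) by ring.
    by rewrite ler_wpM2l// !mulr_ge0.
  apply: (le_trans q1).
  have q2 : w * ((2 + w) * (3 + w)) <= 9 * ((1 + al^-1) ^+ 2 * (2 + al * w ^+ 2) ^+ 2) by lra.
  apply: le_trans (ler_wpM2l _ q2) _; first by rewrite !mulr_ge0.
  have -> : e * (2 * al) * (9 * ((1 + al^-1) ^+ 2 * (2 + al * w ^+ 2) ^+ 2)) =
    18 * al * (1 + al^-1) ^+ 2 * (e * (2 + al * w ^+ 2) ^+ 2) by ring.
  have -> : 72 * al * (1 + al^-1) ^+ 2 = 18 * al * (1 + al^-1) ^+ 2 * 4 by ring.
  have aV1 := addr_ge0 ler01 (ltW aV).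
  by apply: ler_wpM2l => //; rewrite !mulr_ge0.
have [z zx ->] : exists2 z, `|z - x| <= 1 &
    `|gauss al x - gauss al y| = `|gauss al z * - (2 * al * z)| * `|x - y|.
  have cG a b : {within `[a, b], continuous (gauss al)}.
    apply: continuous_subspaceT => z.
    by apply/differentiable_continuous/derivable1_diffP; have [] := is_derive_gauss z.
  have [xly|ylx|<-] := ltgtP x y.
  - have [z] := MVT xly (fun z _ => is_derive_gauss z) (cG _ _).
    rewrite in_itv/= => /andP[xz zy] E; exists z.
      by move: xy; rewrite !ler_norml; lra.
    by rewrite distrC E normrM [ `|x - y|]distrC.
  - have [z] := MVT ylx (fun z _ => is_derive_gauss z) (cG _ _).
    rewrite in_itv/= => /andP[xz zy] E; exists z.
      by move: xy; rewrite !ler_norml; lra.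
    by rewrite E normrM.
  - by exists x; rewrite !subrr normr0 ?mulr0.
by rewrite ler_wpM2r// slope.
Qed.
End gauss.
End Lattice.

(** * Zeros of lattice sums of Gaussians *)

Section Zeros.
Variable R : realType.
Implicit Types (c : int -> R) (x M r : R).
Variables (al : R).
Hypothesis al0 : 0 < al.

Lemma expR_exprz x k : expR x ^ k = expR (x * k%:~R).
Proof.
case: k => n; first by rewrite -exprnP -expRM_natr.
by rewrite NegzE -exprnN -expRM_natr mulrNz mulrN expRN.
Qed.

(** Complete the square: al r^2 + al k^2 - 2 al r k = al (r - k)^2 >= 0. *)
Lemma gauss_coef_bound c M r k : (forall k, `|c k| <= M) ->
  `|c k * gauss al k%:~R| * expR (2 * al * r) ^ k <= M * expR (al * r ^+ 2).
Proof.
move=> cM; rewrite normrM (gtr0_norm (expR_gt0 _)) -[leLHS]mulrA; apply: ler_pM => //.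
  by rewrite mulr_ge0 ?expR_ge0 ?exprz_ge0 ?expR_ge0.
rewrite expR_exprz /gauss -expRD ler_expR -subr_ge0.
have -> : al * r ^+ 2 - (- (al * k%:~R ^+ 2) + 2 * al * r * k%:~R) =
  al * (r - k%:~R) ^+ 2 by ring.
by rewrite mulr_ge0 ?sqr_ge0 ?ltW.
Qed.

Lemma gauss_coef_rapid c M : (forall k, `|c k| <= M) ->
  rapid (fun k => c k * gauss al k%:~R).
Proof.
move=> cM S S1; have S0 : 0 < S by rewrite (lt_le_trans _ S1).
pose r := ln S / (2 * al); have a2 : 2 * al != 0 by rewrite mulf_neq0 ?gt_eqF.
have rS : expR (2 * al * r) = S by rewrite /r mulrCA divff// mulr1 lnK.
have rS' : expR (2 * al * - r) = S^-1 by rewrite mulrN expRN rS.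
exists (M * expR (al * r ^+ 2)) => -[n|n].
  by have := gauss_coef_bound r (Posz n) cM; rewrite rS.
have := gauss_coef_bound (- r) (Negz n) cM; rewrite rS' sqrrN.
by rewrite !NegzE exprz_inv opprK.
Qed.

(** Expanding (x - k)^2 shows that the lattice sum is exp (- al x^2) times the
    Laurent series with coefficients c_k exp (- al k^2) at exp (2 al x). *)
Lemma gauss_zero_laurent_root c M x : (forall k, `|c k| <= M) ->
  lattice_sum c (gauss al) x = 0 ->
  laurent_root (fun k => c k * gauss al k%:~R) (expR (2 * al * x)).
Proof.
move=> cM cx0; apply: bisum0_laurent_root; first exact: expR_gt0.
  exact: gauss_coef_rapid cM.
have [K GK] := gauss_decay al0.
have h := @lattice_sum_cvg _ _ _ _ _ cM GK x; rewrite cx0 in h.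
rewrite (_ : bipartial _ =
   (fun n => (gauss al x)^-1 * lattice_partial c (gauss al) n x)).
  by rewrite -[X in _ --> X](mulr0 (gauss al x)^-1); apply: cvgM => //; exact: cvg_cst.
apply/funext => n; rewrite /lattice_partial /bipartial /series/= mulr_sumr.
have E k : c k * gauss al k%:~R * expR (2 * al * x) ^ k =
   (gauss al x)^-1 * (c k * gauss al (x - k%:~R)).
  rewrite mulrCA -mulrA; congr (_ * _).
  rewrite expR_exprz /gauss -expRN -!expRD; congr expR; ring.
by apply: eq_bigr => i _; rewrite mulrDr !E.
Qed.

(** Apply laurent_jensen on the annulus of outer radius S = exp (2 al (r + C)):
    a zero l contributes at least exp (2 al (r - |l|)) to the product, and the
    coefficients are at most M exp (al (r + C)^2) on both boundary circles.  Take
    logarithms.  The left-hand side is the integral over [0, r] of the number of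
    points of ls in [-t, t], as in Jensen's formula. *)
Lemma gauss_zeros_sum c M : (forall k, `|c k| <= M) -> (exists j, c j != 0) ->
  exists C D : R, forall r (ls : seq R), 0 <= r -> uniq ls ->
    (forall l, l \in ls -> `|l| <= r /\ lattice_sum c (gauss al) l = 0) ->
    \sum_(l <- ls) (r - `|l|) <= (r + C) ^+ 2 + D.
Proof.
move=> cM [j cj].
have a2 : 0 < 2 * al by rewrite mulr_gt0.
pose A := `|c j * gauss al j%:~R|.
have A0 : 0 < A by rewrite normr_gt0 mulf_neq0// gt_eqF// expR_gt0.
have M0 : 0 < M by apply: lt_le_trans (cM j); rewrite normr_gt0.
(* enlarging the radius by C absorbs the factor 16 lost per zero *)
pose C := ln 16 / (2 * al).
have C0 : 0 <= C by rewrite divr_ge0 ?(ltW a2)// ln_ge0// ler1n.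
have EC : expR (2 * al * C) = 16 by rewrite /C mulrCA divff ?gt_eqF// mulr1 lnK// posrE.
exists C, (ln ((M / A) ^+ 2) / (2 * al)) => r ls r0 uls lsP.
pose f l := expR (2 * al * l).
have finj : injective f by move=> l l' /expR_inj /(mulfI (lt0r_neq0 a2)).
pose S := f (r + C); have S0 : 0 < S by exact: expR_gt0.
have SV : S^-1 = f (- (r + C)) by rewrite /S /f mulrN expRN.
have f16 l l' : l <= l' -> f (l - C) *+ 2 <= f l' /\ f l *+ 2 <= f (l' + C).
  have f2 l1 : f l1 *+ 2 <= f (l1 + C).
    by rewrite /f mulrDr expRD EC -[leLHS]mulr_natr ler_pM2l ?expR_gt0// ler_nat.
  move=> ll'; split; last first.
    by apply: le_trans (f2 _) _; rewrite ler_expR ler_pM2l// lerD2r.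
  by apply: le_trans (f2 _) _; rewrite subrK ler_expR ler_pM2l.
have uS : uniq (map f ls) by rewrite map_inj_uniq.
have rootS x : x \in map f ls -> laurent_root (fun k => c k * gauss al k%:~R) x.
  by move=> /mapP[l /lsP[_ l0] ->]; exact: gauss_zero_laurent_root l0.
have rangeS x : x \in map f ls -> S^-1 *+ 2 <= x /\ x *+ 2 <= S.
  move=> /mapP[l /lsP[+ _] ->]; rewrite ler_norml => /andP[l1 l2]; split.
    by rewrite SV opprD; apply: (f16 _ _ _).1.
  by apply: (f16 _ _ _).2.
have bS : coef_bound (fun k => c k * gauss al k%:~R) S (M * expR (al * (r + C) ^+ 2)).
  by move=> k; exact: gauss_coef_bound.
have bSV : coef_bound (fun k => c k * gauss al k%:~R) S^-1 (M * expR (al * (r + C) ^+ 2)).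
  by move=> k; rewrite SV -(sqrrN (r + C)); exact: gauss_coef_bound.
have := laurent_jensen j (gauss_coef_rapid cM) S0 uS rootS rangeS bS bSV.
rewrite big_map -/A.
have : \prod_(l <- ls) expR (2 * al * (r - `|l|)) <=
   \prod_(l <- ls) (S * f l / (4 * (1 + f l) ^+ 2)).
  rewrite big_seq [leRHS]big_seq; apply: ler_prod => l /lsP[lr _].
  rewrite expR_ge0/=.
  have fl0 : 0 < f l by exact: expR_gt0.
  have f1 : 0 < 1 + f l by rewrite addr_gt0.
  have -> : expR (2 * al * (r - `|l|)) = S * expR (2 * al * - `|l|) / 16.
    rewrite -EC /S /f -expRD -expRN -expRD; congr expR; ring.
  rewrite -[leRHS]mulrA -[leLHS]mulrA ler_pM2l//.
  rewrite ler_pdivrMr// [leRHS]mulrAC ler_pdivlMr ?mulr_gt0 ?exprn_gt0//.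
  have [l0|l0] := leP 0 l.
    have fl1 : 1 <= f l by rewrite /f -[leLHS]expR0 ler_expR; exact: mulr_ge0 (ltW a2) l0.
    rewrite mulrN expRN ger0_norm// -/(f l) mulrC ler_pdivrMr//.
    nra.
  have fl1 : f l <= 1 by rewrite /f -[leRHS]expR0 ler_expR; exact: mulr_ge0_le0 (ltW a2) (ltW l0).
  rewrite ltr0_norm// opprK -/(f l) ler_pM2l//; nra.
rewrite -expR_sum -mulr_sumr; set s := \sum_(l <- ls) _ => h.
move=> /(le_trans (ler_wpM2l (sqr_ge0 A) h)).
rewrite exprMn mulrC -ler_pdivlMr ?exprn_gt0//.
rewrite [leRHS]mulrAC -expr_div_n.
have -> : expR (al * (r + C) ^+ 2) ^+ 2 = expR (2 * al * (r + C) ^+ 2).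
  by rewrite -expRM_natl; congr expR; ring.
have MA : 0 < (M / A) ^+ 2 by rewrite exprn_gt0// divr_gt0.
rewrite -[X in _ <= X * _]lnK ?posrE// -expRD ler_expR addrC -ler_pdivlMl//.
by rewrite mulrDr mulrA mulVf ?gt_eqF// mul1r [_^-1 * _]mulrC.
Qed.
End Zeros.

(** * Integrable functions on the line *)

Section Integrals.
Variable R : realType.
Notation mu := (@lebesgue_measure R).
Implicit Types (f g h u : R -> R) (x y B K M : R).
Definition L1 f := mu.-integrable setT (EFin \o f).

Lemma continuous_integrable_itv f a b : continuous f ->
  mu.-integrable `[a, b] (EFin \o f).
Proof.
move=> cf; apply: continuous_compact_integrable; first exact: segment_compact.
exact: continuous_subspaceT.
Qed.

Lemma L1_dominated f g : measurable_fun setT f -> L1 g ->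
  (forall x, `|f x| <= g x) -> L1 f.
Proof.
move=> mf ig fg; apply: le_integrable ig => //; first exact/measurable_EFinP.
by move=> x _ /=; rewrite lee_fin (le_trans (fg x))// ler_norm.
Qed.

Lemma L1_measurable f : L1 f -> measurable_fun setT f.
Proof. by move=> /integrableP[/measurable_EFinP]. Qed.

Lemma L1_mul_bounded f g B : L1 f -> measurable_fun setT g ->
  (forall x, `|g x| <= B) -> L1 (fun x => f x * g x).
Proof.
move=> If mg gB; apply: (@L1_dominated _ (fun x => `|f x| * B)).
- by apply: measurable_funM => //; exact: L1_measurable.
- apply: (@eq_integrable _ _ _ mu setT measurableT (fun x => B%:E * (abse (f x)%:E))%E).
    by move=> x _ /=; rewrite mulrC EFinM.
  by apply: integrableZl => //; exact: integrable_abse.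
- by move=> x; rewrite normrM ler_wpM2l.
Qed.

Lemma L1_norm f : L1 f -> L1 (fun x => `|f x|).
Proof. by move=> If; exact: integrable_norm If. Qed.

Lemma L1D f g : L1 f -> L1 g -> L1 (fun x => f x + g x).
Proof. by move=> If Ig; exact: (integrableD measurableT If Ig). Qed.

Lemma L1Z r f : L1 f -> L1 (fun x => r * f x).
Proof. by move=> If; exact: (integrableZl measurableT r If). Qed.

Lemma L1N f : L1 f -> L1 (fun x => - f x).
Proof. by move=> If; exact: (integrableN If). Qed.

Lemma measurable_shift c : measurable_fun setT (fun x : R => x + c).
Proof. exact: measurable_funD. Qed.

Let translate c : measurableTypeR R -> measurableTypeR R := fun x => x + c.

Let measurable_translate c : measurable_fun setT (translate c).
Proof. exact: measurable_shift. Qed.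

Let pushforward_translate c : {measure set (measurableTypeR R) -> \bar R} :=
  measure_function_pushforward__canonical__measure_function_Measure mu (measurable_translate c).

(** Both measures agree on half-open intervals. *)
Lemma lebesgue_measure_shift c (A : set (measurableTypeR R)) : measurable A ->
  mu A = pushforward_translate c A.
Proof.
apply: lebesgue_measure_unique => X [[a b] _ <-].
rewrite /pushforward_translate/= /pushforward/=.
have -> : (fun x => x + c) @^-1` `]a, b]%classic = `]a - c, b - c]%classic.
  by apply/seteqP; split=> x /=; rewrite !in_itv/= ltrBlDr lerBrDr.
rewrite !lebesgue_measure_itv/= !lte_fin ltrD2r.
by case: ifP => // _; rewrite -!EFinB; congr EFin; ring.
Qed.

Lemma L1_shift f c : L1 f -> L1 (fun x => f (x + c)).
Proof.
move=> If; have mf := L1_measurable If.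
apply/integrableP; split.
  by apply/measurable_EFinP; apply: measurableT_comp (measurable_shift c).
case/integrableP : (If) => _; apply: le_lt_trans.
have -> : (\int[mu]_x `|(EFin \o f) x| = \int[pushforward_translate c]_x `|(EFin \o f) x|)%E.
  by apply: eq_measure_integral => A mA _; exact: lebesgue_measure_shift.
rewrite (ge0_integral_pushforward (measurable_translate c))//.
by do 2 apply: measurableT_comp => //; exact/measurable_EFinP.
Qed.

Lemma Rintegral_shift f c : L1 f -> \int[mu]_x f (x + c) = \int[mu]_x f x.
Proof.
move=> If; have mf := L1_measurable If; have Is := L1_shift c If.
rewrite /Rintegral; congr fine.
have -> : (\int[mu]_x (f x)%:E = \int[pushforward_translate c]_x (f x)%:E)%E.
  by apply: eq_measure_integral => A mA _; exact: lebesgue_measure_shift.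
rewrite (integral_pushforward (measurable_translate c))//.
exact/measurable_EFinP.
Qed.

Lemma Rintegral_norm_le f g : L1 g -> measurable_fun setT f -> (forall x, `|f x| <= g x) ->
  `|\int[mu]_x f x| <= \int[mu]_x g x.
Proof.
move=> Ig mf fg; have If := L1_dominated mf Ig fg.
apply: le_trans (le_normr_Rintegral _ If) _ => //.
by apply: le_Rintegral => //; exact: L1_norm.
Qed.

Lemma Rintegral_dominated_cvg (fn : nat -> R -> R) f g :
  (forall n, measurable_fun setT (fn n)) -> L1 g ->
  (forall n x, `|fn n x| <= g x) -> (forall x, fn ^~ x @ \oo --> f x) ->
  L1 f /\ \int[mu]_x fn n x @[n --> \oo] --> \int[mu]_x f x.
Proof.
move=> mfn Ig fng fnf.
have mf : measurable_fun setT f by apply: (measurable_fun_cvg mfn) => x _.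
have mfn' n : measurable_fun setT (EFin \o fn n) by exact/measurable_EFinP.
have mf' : measurable_fun setT (EFin \o f) by exact/measurable_EFinP.
have cfn : {ae mu, forall x, setT x -> (EFin \o fn n) x @[n --> \oo] --> (EFin \o f) x}.
  by apply: aeW => x _; apply: cvg_EFin; [exact: nearW|exact: fnf].
have dfn : {ae mu, forall x n, setT x -> (`|(EFin \o fn n) x| <= (EFin \o g) x)%E}.
  by apply: aeW => x n _; rewrite /= lee_fin.
have [If _ h] := @dominated_convergence _ _ _ mu _ measurableT _ _ _ mfn' mf' cfn Ig dfn.
split => //; apply: fine_cvg.
by rewrite fineK//; exact: integrable_fin_num If.
Qed.

End Integrals.

(** * Convolution with an exponential density *)

Section ExpConv.
Variable R : realType.
Notation mu := (@lebesgue_measure R).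
Implicit Types (u v w : R -> R) (x y B K M d s : R).

(** The density exp (- s) on the half-line s >= 0. *)
Definition expdens : R -> R := exponential_pdf 1.

Lemma expdens_ge0 s : 0 <= expdens s.
Proof. exact: exponential_pdf_ge0. Qed.

Lemma expdensE s : expdens s = if 0 <= s then expR (- s) else 0.
Proof.
have [s0|s0] := leP 0 s; last by rewrite /expdens lt0_exponential_pdf.
by rewrite /expdens exponential_pdfE// mul1r mulN1r.
Qed.

Lemma L1_expdens : L1 expdens.
Proof. exact: integrable_exponential_pdf. Qed.

Lemma measurable_expdens : measurable_fun setT expdens.
Proof. exact: L1_measurable L1_expdens. Qed.

Lemma integral_expdens : \int[mu]_s expdens s = 1.
Proof. by rewrite /Rintegral integral_exponential_pdf. Qed.

(** A class of functions that is stable under lattice sums of Gaussians and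
    under exponential convolutions, by elementary estimates only. *)
Definition bounded_lip u := (exists B, forall x, `|u x| <= B) /\
  (exists K, forall x y, `|u x - u y| <= K * `|x - y|).

Lemma bounded_lip_continuous u : bounded_lip u -> continuous u.
Proof.
move=> [_ [K uK]] x; apply/cvgrPdist_lt => e e0.
have K0 : 0 <= K.
  by have := le_trans (normr_ge0 _) (uK 1 0); rewrite subr0 normr1 mulr1.
have K1 : 0 < K + 1 by rewrite ltr_wpDl.
near=> y; apply: le_lt_trans (uK x y) _.
apply: (@le_lt_trans _ _ ((K + 1) * `|x - y|)); first by rewrite ler_wpM2r// lerDl.
rewrite mulrC -ltr_pdivlMr//; near: y.
by apply/nbhs_ballP; exists (e / (K + 1)) => //=; rewrite divr_gt0.
Unshelve. all: by end_near. Qed.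

Lemma bounded_lip_measurable u : bounded_lip u -> measurable_fun setT u.
Proof. by move=> /bounded_lip_continuous; exact: continuous_measurable_fun. Qed.

Lemma measurable_affine u x d : measurable_fun setT u ->
  measurable_fun setT (fun s => u (x - d * s)).
Proof.
by move=> mu_; apply: (measurableT_comp mu_); apply: measurable_funB => //; exact: measurable_funM.
Qed.

(** For d != 0 this is the bounded solution w of w + d w' = u; the formula covers
    both signs of d, and d = 0 gives the identity. *)
Definition exp_conv d u x := \int[mu]_s (expdens s * u (x - d * s)).

Lemma L1_exp_conv_integrand d u x B : measurable_fun setT u -> (forall x, `|u x| <= B) ->
  L1 (fun s => expdens s * u (x - d * s)).
Proof.
move=> um uB; apply: (@L1_mul_bounded _ _ _ B) => //; first exact: L1_expdens.
exact: measurable_affine.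
Qed.

Lemma exp_conv_bounded d u B : measurable_fun setT u -> (forall x, `|u x| <= B) ->
  forall x, `|exp_conv d u x| <= B.
Proof.
move=> um uB x; have B0 : 0 <= B by rewrite (le_trans _ (uB 0)).
rewrite -[leRHS]mulr1 -integral_expdens -RintegralZl//; last exact: L1_expdens.
apply: Rintegral_norm_le; first exact: (L1Z B L1_expdens).
  by apply: measurable_funM; [exact: measurable_expdens|exact: measurable_affine].
move=> s; rewrite normrM ger0_norm ?expdens_ge0// mulrC.
by rewrite ler_wpM2r ?expdens_ge0.
Qed.

Lemma exp_convD d u v x B C : measurable_fun setT u -> measurable_fun setT v ->
  (forall x, `|u x| <= B) -> (forall x, `|v x| <= C) ->
  exp_conv d (fun x => u x + v x) x = exp_conv d u x + exp_conv d v x.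
Proof.
move=> um vm uB vB; rewrite /exp_conv -RintegralD//; last 2 first.
- exact: L1_exp_conv_integrand uB.
- exact: L1_exp_conv_integrand vB.
by apply: eq_Rintegral => s _; rewrite mulrDr.
Qed.

Lemma exp_convZ d u x r B : measurable_fun setT u -> (forall x, `|u x| <= B) ->
  exp_conv d (fun x => r * u x) x = r * exp_conv d u x.
Proof.
move=> um uB; rewrite /exp_conv -RintegralZl//; last exact: L1_exp_conv_integrand uB.
by apply: eq_Rintegral => s _; rewrite mulrCA.
Qed.

Lemma exp_conv_bounded_lip d u : bounded_lip u -> bounded_lip (exp_conv d u).
Proof.
move=> bu; have um := bounded_lip_measurable bu.
have [[B uB] [K uK]] := bu; split; first by exists B; exact: exp_conv_bounded.
exists K => x y.
have sm z : exp_conv d u z = exp_conv d (fun t => u (t + z)) 0.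
  by apply: eq_Rintegral => s _; rewrite add0r addrC.
have mz (z : R) : measurable_fun setT (fun t : R => u (t + z)).
  by apply: (measurableT_comp um); exact: measurable_shift.
rewrite !sm -[X in _ - X]mul1r -mulNr -(exp_convZ _ _ _ (mz y) (fun=> uB _)).
have m2 : measurable_fun setT (fun t : R => -1 * u (t + y)).
  by apply: measurable_funM => //; exact: mz.
have b2 (t : R) : `|-1 * u (t + y)| <= B by rewrite mulN1r normrN.
rewrite -(exp_convD _ _ (mz x) m2 (fun=> uB _) b2).
apply: exp_conv_bounded => [|t].
  by apply: measurable_funD => //; apply: measurable_funM.
rewrite mulN1r; apply: le_trans (uK _ _) _.
by rewrite (_ : t + x - (t + y) = x - y)//; ring.
Qed.

Lemma exp_conv0 u : exp_conv 0 u = u.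
Proof.
apply/funext => x; rewrite /exp_conv.
under eq_Rintegral do rewrite mul0r subr0.
by rewrite RintegralZr//; [rewrite integral_expdens mul1r|exact: L1_expdens].
Qed.

Lemma exp_conv_translate d u a x : exp_conv d (fun t => u (t - a)) x = exp_conv d u (x - a).
Proof. by apply: eq_Rintegral => s _; congr (_ * u _); ring. Qed.

Lemma exp_conv_cvg d (un : nat -> R -> R) u B x :
  (forall n, measurable_fun setT (un n)) -> (forall n y, `|un n y| <= B) ->
  (forall y, un ^~ y @ \oo --> u y) ->
  exp_conv d (un n) x @[n --> \oo] --> exp_conv d u x.
Proof.
move=> mun unB unu.
apply: (@Rintegral_dominated_cvg R (fun n s => expdens s * un n (x - d * s))
  (fun s => expdens s * u (x - d * s)) (fun s => B * expdens s) _ _ _ _).2 => [n||n s|s].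
- by apply: measurable_funM; [exact: measurable_expdens|exact: measurable_affine].
- exact: (L1Z B L1_expdens).
- by rewrite normrM ger0_norm ?expdens_ge0// mulrC ler_wpM2r ?expdens_ge0.
- by apply: cvgM; [exact: cvg_cst|exact: unu].
Qed.

(** The exponential law has no memory, except for the part of the mass that a
    shift moves across 0. *)
Lemma expdens_shift h s : 0 <= h -> expdens (s + h) =
  expR (- h) * (expdens s + ((fun s => expR (- s)) \_ `[- h, 0[) s).
Proof.
move=> h0; rewrite !expdensE patchE/=.
rewrite -lerBlDr sub0r.
have [s0|s0] := leP 0 s.
  rewrite (le_trans _ s0) ?oppr_le0// memNset; last first.
    by rewrite /= in_itv/= ltNge s0 andbF.
  by rewrite addr0 -expRD opprD addrC.
have [sh|sh] := leP (- h) s.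
  rewrite mem_set; last by rewrite /= in_itv/= sh s0.
  by rewrite add0r -expRD opprD addrC.
rewrite memNset ?addr0 ?mulr0//.
by rewrite /= in_itv/= leNgt sh.
Qed.

Lemma continuous_exp_weight d u x : bounded_lip u ->
  continuous (fun s => expR (- s) * u (x - d * s)).
Proof.
move=> bu s; apply: cvgM.
  by apply: (@continuous_comp _ _ _ (fun s => - s) expR); [exact: continuousN|exact: continuous_expR].
apply: (@continuous_comp _ _ _ (fun s => x - d * s) u); last exact: bounded_lip_continuous.
by apply: continuousB; [exact: cvg_cst|apply: cvgM; [exact: cvg_cst|exact: cvg_id]].
Qed.

(** The integrated form of the differential equation w + d w' = u: it expresses
    the increment of exp (h) w (x + d h) as an integral of u. *)
Lemma exp_conv_memoryless d u x h : bounded_lip u -> 0 <= h ->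
  exp_conv d u (x + d * h) = expR (- h) *
   (exp_conv d u x + \int[mu]_(s in `[- h, 0]) (expR (- s) * u (x - d * s))).
Proof.
move=> bu h0; have um := bounded_lip_measurable bu; have [[B uB] _] := bu.
rewrite /exp_conv -(Rintegral_shift h); last exact: L1_exp_conv_integrand uB.
have Ic := continuous_integrable_itv (- h) 0 (@continuous_exp_weight d u x bu).
have Io : mu.-integrable `[- h, 0[ (EFin \o (fun s => expR (- s) * u (x - d * s))).
  by apply: integrableS Ic => //; exact: subset_itv_co_cc.
have Ir : L1 ((fun s => expR (- s) * u (x - d * s)) \_ `[- h, 0[%classic).
  by have /integrable_mkcond := Io; rewrite restrict_EFin; apply.
rewrite -(@Rintegral_itv_bndo_bndc _ (BLeft (- h)) 0)//.
rewrite (Rintegral_mkcond mu `[- h, 0[%classic) -RintegralD//; last first.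
  exact: L1_exp_conv_integrand uB.
rewrite -RintegralZl//; last first.
  by apply: L1D; [exact: L1_exp_conv_integrand uB|exact: Ir].
apply: eq_Rintegral => s _; rewrite expdens_shift//.
rewrite (_ : x + d * h - d * (s + h) = x - d * s); last by ring.
rewrite -mulrA; congr (_ * _); rewrite mulrDl; congr (_ + _).
by rewrite !patchE; case: ifP => //; rewrite mul0r.
Qed.

(** By exp_conv_memoryless the integral of s |-> exp (- s) u (x - d s) between
    the parameters of the two zeros vanishes.  Rolle's theorem for its primitive
    gives a zero of the integrand. *)
Lemma exp_conv_rolle d u a b : bounded_lip u -> d != 0 -> a < b ->
  exp_conv d u a = 0 -> exp_conv d u b = 0 ->
  exists2 z, a < z < b & u z = 0.
Proof.
move=> bu d0 ab ua ub.
(* x is the end point from which the other one is reached with a positive step,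
   so that the sign of d does not matter *)
suff [x [h [h0 xh E1 E2]]] : exists x h, [/\ 0 < h,
    (forall s, - h < s < 0 -> a < x - d * s < b), exp_conv d u x = 0 & exp_conv d u (x + d * h) = 0].
  have := exp_conv_memoryless d x bu (ltW h0); rewrite E1 E2 add0r => /esym/eqP.
  rewrite mulf_eq0 gt_eqF ?expR_gt0//= => /eqP I0.
  set k := fun s => expR (- s) * u (x - d * s) in I0.
  have ci : continuous k by exact: continuous_exp_weight.
  have Ic := continuous_integrable_itv (- h) 0 ci.
  pose F t := \int[mu]_(s in `[- h, t]) k s.
  have hN : - h < 0 by rewrite oppr_lt0.
  have dF t : t \in `]- h, 0[ -> derivable F t 1 /\ F^`()%classic t = k t.
    rewrite in_itv/= => /andP[ht t0].
    by apply: (continuous_FTC1 t0 Ic) => //; exact: ci.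
  have [t th [_ Ft]] : exists2 t, t \in `]- h, 0[ & is_derive t 1 F 0.
    apply: Rolle => //.
    - by move=> t /dF[].
    - exact: parameterized_integral_continuous (ltW hN) Ic.
    - by rewrite /F I0 set_itv1 Rintegral_set1.
  have [_] := dF t th; rewrite derive1E Ft => /esym/eqP.
  rewrite mulf_eq0 gt_eqF ?expR_gt0//= => /eqP ut.
  by exists (x - d * t) => //; apply: xh; move: th; rewrite in_itv.
have [dn|dp|d00] := ltgtP d 0; last by rewrite d00 eqxx in d0.
  exists b, ((a - b) / d).
  have E : b + d * ((a - b) / d) = a by field.
  rewrite E; split => // [|s /andP[s1 s2]].
    by rewrite nmulr_lgt0 ?invr_lt0// subr_lt0.
  have ds : 0 < d * s by rewrite nmulr_rgt0.
  rewrite ltrBlDr ltrDl ds andbT -{1}E.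
  rewrite -mulrN ltrD2l ltr_nM2l//.
  by rewrite ltrNl.
exists a, ((b - a) / d).
have E : a + d * ((b - a) / d) = b by field.
rewrite E; split => // [|s /andP[s1 s2]].
  by rewrite divr_gt0// subr_gt0.
have ds : d * s < 0 by rewrite pmulr_rlt0.
rewrite ltrBrDr gtrDl ds/= -[ltRHS]E.
by rewrite -mulrN ltrD2l ltr_pM2l// ltrNl.
Qed.

End ExpConv.

(** * Improper integrals and interchange of integrals *)

Section Improper.
Variable R : realType.
Notation mu := (@lebesgue_measure R).
Implicit Types (f g u v F : R -> R) (x y a B K M d s w : R).

Lemma Rintegral_FTC f F a b : a < b -> continuous f ->
  (forall x, is_derive x 1 F (f x)) -> \int[mu]_(x in `[a, b]) f x = F b - F a.
Proof.
move=> ab cf dF; have cF : continuous F.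
  by move=> x; apply/differentiable_continuous/derivable1_diffP; have [] := dF x.
rewrite /Rintegral (@continuous_FTC2 _ f F)//.
- exact: continuous_subspaceT.
- split; first by move=> x _; have [] := dF x.
    by apply: cvg_at_right_filter; exact: cF.
  by apply: cvg_at_left_filter; exact: cF.
- by move=> x _; rewrite derive1E; have [_ ->] := dF x.
Qed.

Lemma Rintegral_exhaustion f (a b : nat -> R) : L1 f ->
  (forall x, \forall n \near \oo, f x = 0 \/ a n <= x <= b n) ->
  \int[mu]_(x in `[a n, b n]) f x @[n --> \oo] --> \int[mu]_x f x.
Proof.
move=> If H; have mf := L1_measurable If.
under eq_fun do rewrite Rintegral_mkcond.
apply: (Rintegral_dominated_cvg _ (L1_norm If) _ _).2 => [n|n x|x].
- by apply/(measurable_restrictT _ _).1 => //; exact: measurable_funTS.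
- by rewrite patchE; case: ifP => // _; rewrite normr0.
- apply: cvg_near_cst; have := H x; apply: filterS => n [fx0|xab].
    by rewrite patchE; case: ifP => // _; rewrite fx0.
  by rewrite patchE mem_set//= in_itv.
Qed.

(** The integral over [-n, n] is F n - F (- n). *)
Lemma Rintegral_deriv0 f F : L1 f -> continuous f ->
  (forall x, is_derive x 1 F (f x)) ->
  F n%:R @[n --> \oo] --> (0 : R) -> F (- n%:R) @[n --> \oo] --> (0 : R) ->
  \int[mu]_x f x = 0.
Proof.
move=> If cf dF Fp Fn.
have H x : \forall n \near \oo, f x = 0 \/ - n%:R <= x <= (n%:R : R).
  have := nbhs_infty_ger `|x|; apply: filterS => n xn; right.
  by rewrite -ler_norml.
apply: (@cvg_unique _ _ ((fun n => F n%:R - F (- n%:R)) @ \oo)) => //; last first.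
  by rewrite -(subr0 0); apply: cvgB.
have := Rintegral_exhaustion If H; apply: cvg_trans.
apply: near_eq_cvg; near=> n.
rewrite (Rintegral_FTC _ cf dF)// gtrN// ltr0n.
by near: n; exists 1%N.
Unshelve. all: by end_near. Qed.

Lemma Rintegral_expdens f F B : continuous f -> (forall x, `|f x| <= B) ->
  (forall x, is_derive x 1 F (expR (- x) * f x)) ->
  F n%:R @[n --> \oo] --> (0 : R) ->
  \int[mu]_s (expdens s * f s) = - F 0.
Proof.
move=> cf fB dF Fp.
have mf : measurable_fun setT f by exact: continuous_measurable_fun.
have If : L1 (fun s => expdens s * f s) by exact: L1_mul_bounded (L1_expdens _) mf fB.
have H x : \forall n \near \oo, expdens x * f x = 0 \/ 0 <= x <= (n%:R : R).
  have := nbhs_infty_ger x; apply: filterS => n xn.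
  rewrite expdensE; case: ifP => x0; first by right.
  by left; rewrite mul0r.
have limF : F n%:R - F 0 @[n --> \oo] --> - F 0.
  by rewrite -[X in _ --> X]sub0r; apply: cvgB; [exact: Fp|exact: cvg_cst].
apply: (cvg_unique _ _ limF) => //.
have := Rintegral_exhaustion If H; apply: cvg_trans.
apply: near_eq_cvg; near=> n.
rewrite -(@Rintegral_FTC (fun s => expR (- s) * f s) F 0)//.
- by apply: eq_Rintegral => s; rewrite inE/= in_itv/= expdensE => /andP[-> _].
- by rewrite ltr0n; near: n; exists 1%N.
- move=> s; apply: cvgM; last exact: cf.
  by apply: (@continuous_comp _ _ _ (fun s => - s) expR); [exact: continuousN|exact: continuous_expR].
Unshelve. all: by end_near. Qed.

Lemma is_derive_comp_affine F dF a b x : is_derive (a * x + b) 1 F dF ->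
  is_derive x 1 (fun x => F (a * x + b)) (dF * a).
Proof.
move=> h; apply: (@is_derive1_comp _ F (fun x => a * x + b)).
by apply: is_derive_eq; rewrite /GRing.scale/=; ring.
Qed.

Lemma expRN_cvg0 : expR (- n%:R) @[n --> \oo] --> (0 : R).
Proof.
by apply: (cvg_comp (fun n : nat => n%:R : R) (fun x : R => expR (- x)));
  [exact: cvgr_idn|exact: cvgr_expR].
Qed.

Lemma cos_norm_le1 x : `|cos x| <= 1.
Proof. by rewrite ler_norml cos_geN1 cos_le1. Qed.

Lemma sin_norm_le1 x : `|sin x| <= 1.
Proof. by rewrite ler_norml sin_geN1 sin_le1. Qed.

Lemma continuous_cos_affine a b : continuous (fun x => cos (a * x + b)).
Proof.
move=> s; apply: (@continuous_comp _ _ _ (fun s => a * s + b) cos); last exact: continuous_cos.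
by apply: cvgD; [apply: cvgM; [exact: cvg_cst|exact: cvg_id]|exact: cvg_cst].
Qed.

Lemma continuous_sin_affine a b : continuous (fun x => sin (a * x + b)).
Proof.
move=> s; apply: (@continuous_comp _ _ _ (fun s => a * s + b) sin); last exact: continuous_sin.
by apply: cvgD; [apply: cvgM; [exact: cvg_cst|exact: cvg_id]|exact: cvg_cst].
Qed.

(** Sines are treated as cosines with a phase, so that only one trigonometric
    integral has to be studied. *)
Lemma sin_as_cos x : sin x = cos (x + - (pi / 2)).
Proof. by rewrite cosD cosN sinN cos_pihalf sin_pihalf; ring. Qed.

(** The real part of exp (i b) / (1 - i a), by means of an explicit primitive. *)
Lemma expdens_cos a b :
  \int[mu]_s (expdens s * cos (a * s + b)) = (cos b - a * sin b) / (1 + a ^+ 2).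
Proof.
have a1 : 0 < 1 + a ^+ 2 by rewrite ltr_pwDl// sqr_ge0.
pose F s := (1 + a ^+ 2)^-1 * (expR (- s) * (a * sin (a * s + b) - cos (a * s + b))).
have -> : (cos b - a * sin b) / (1 + a ^+ 2) = - F 0.
  by rewrite /F oppr0 expR0 mulr0 add0r; ring.
apply: (@Rintegral_expdens _ _ 1).
- exact: continuous_cos_affine.
- by move=> s; exact: cos_norm_le1.
- move=> s.
  have d1 : is_derive s 1 (fun s => sin (a * s + b)) (cos (a * s + b) * a).
    exact: (is_derive_comp_affine (is_derive_sin _)).
  have d2 : is_derive s 1 (fun s => cos (a * s + b)) (- sin (a * s + b) * a).
    exact: (is_derive_comp_affine (is_derive_cos _)).
  have d3 : is_derive s 1 (fun s => expR (- s)) (expR (- s) * -1).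
    have := @is_derive_comp_affine expR (expR (-1 * s + 0)) (-1) 0 s (is_derive_expR _).
    by rewrite addr0 mulN1r; under eq_fun do rewrite addr0 mulN1r.
  rewrite /F; apply: is_derive_eq; rewrite /GRing.scale/=.
  by field; rewrite gt_eqF.
- apply: norm_cvg0.
  apply: (@squeeze_cvgr _ _ _ _ (fun=> 0) (fun n => (1 + a ^+ 2)^-1 * (`|a| + 1) * expR (- n%:R))).
  + near=> n; rewrite normr_ge0/= /F !normrM ger0_norm ?invr_ge0 ?(ltW a1)//.
    rewrite -mulrA ler_wpM2l ?invr_ge0 ?(ltW a1)// mulrC (ger0_norm (expR_ge0 _)).
    rewrite ler_wpM2r ?expR_ge0// (le_trans (ler_normB _ _))// lerD//.
      by rewrite normrM ler_piMr// sin_norm_le1.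
    exact: cos_norm_le1.
  + exact: cvg_cst.
  + rewrite -[X in _ --> X](mulr0 ((1 + a ^+ 2)^-1 * (`|a| + 1))).
    by apply: cvgM; [exact: cvg_cst|exact: expRN_cvg0].
Unshelve. all: by end_near. Qed.

End Improper.

Section FubiniReal.
Variable R : realType.
Notation mu := (@lebesgue_measure R).
Implicit Types (f g u v : R -> R).
Variable F : R -> R -> R.
Hypothesis mF : measurable_fun [set: measurableTypeR R * measurableTypeR R] (fun z => F z.1 z.2).
Hypothesis L1x : forall x, L1 (F x).
Hypothesis L1s : forall s, L1 (F ^~ s).
Variable g : R -> R.
Hypothesis Ig : L1 g.
Hypothesis Fg : forall s, \int[mu]_x `|F x s| <= g s.

Let f : measurableTypeR R * measurableTypeR R -> \bar R := fun z => (F z.1 z.2)%:E.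

Let If : (mu \x mu)%E.-integrable setT f.
Proof.
apply/integrable21ltyP; first exact/measurable_EFinP.
case/integrableP : Ig => mg; apply: le_lt_trans.
apply: ge0_le_integral => //.
- by move=> x _; exact: integral_ge0.
- apply: (measurable_fun_fubini_tonelli_G (m1 := mu) (abse \o f)) => //.
    by apply: measurableT_comp => //; exact/measurable_EFinP.
  by move=> x; exact: abse_ge0.
- by apply: measurableT_comp.
- move=> s _; rewrite /f/=.
  apply: (@le_trans _ _ (g s)%:E); last by rewrite lee_fin ler_norm.
  apply: le_trans (_ : (\int[mu]_x `|F x s|)%:E <= _)%E; last by rewrite lee_fin.
  by rewrite /Rintegral fineK//; apply: integrable_fin_num => //; exact: L1_norm (L1s s).
Qed.

Let EFin_x x : (\int[mu]_s (F x s)%:E)%E = (\int[mu]_s F x s)%:E.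
Proof. by rewrite /Rintegral fineK//; apply: integrable_fin_num => //; exact: L1x. Qed.

Let EFin_s s : (\int[mu]_x (F x s)%:E)%E = (\int[mu]_x F x s)%:E.
Proof. by rewrite /Rintegral fineK//; apply: integrable_fin_num => //; exact: L1s. Qed.

Lemma L1_Rintegral : L1 (fun x => \int[mu]_s F x s).
Proof.
have := integrable_fubini_F If; rewrite /L1; congr (_.-integrable _ _).
by apply/funext => x; rewrite /fubini_F /f/= EFin_x.
Qed.

Lemma Rintegral_fubini :
  \int[mu]_x \int[mu]_s F x s = \int[mu]_s \int[mu]_x F x s.
Proof.
have := Fubini If; rewrite /f/= => h.
rewrite {1}/Rintegral; under eq_integral do rewrite -EFin_x.
rewrite h {1}[RHS]/Rintegral; congr fine.
by apply: eq_integral => s _; rewrite EFin_s.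
Qed.
End FubiniReal.

(** * Fourier transform of an exponential convolution *)

Section Trig.
Variable R : realType.
Notation mu := (@lebesgue_measure R).
Implicit Types (f g u v F : R -> R) (x y a b B K M d s w ph : R).

(** With the phase 0 this is the cosine transform, with the phase - pi / 2 the
    sine transform. *)
Definition trigT u w ph := \int[mu]_x (u x * cos (w * x + ph)).

Lemma measurable_cos_affine a b : measurable_fun setT (fun x => cos (a * x + b)).
Proof. by apply: continuous_measurable_fun; exact: continuous_cos_affine. Qed.

Lemma L1_trig u w ph : L1 u -> L1 (fun x => u x * cos (w * x + ph)).
Proof.
move=> Iu; apply: (L1_mul_bounded Iu (measurable_cos_affine _ _)) => x.
exact: cos_norm_le1.
Qed.

Lemma trigT_phase u w ph th : L1 u ->
  trigT u w (ph + th) = cos th * trigT u w ph - sin th * trigT u w (ph - pi / 2).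
Proof.
move=> Iu; rewrite /trigT -!RintegralZl//; [|exact: L1_trig..].
rewrite -RintegralB//; last 2 first.
- by apply: L1Z; exact: L1_trig.
- by apply: L1Z; exact: L1_trig.
apply: eq_Rintegral => x _.
by rewrite addrA cosD (addrA (w * x)) -sin_as_cos; ring.
Qed.

Section exp_conv.
Variables (u : R -> R) (B d : R).
Hypotheses (Iu : L1 u) (uB : forall x, `|u x| <= B).

Let F x s := expdens s * u (x - d * s).

Let measurable_F : measurable_fun [set: measurableTypeR R * measurableTypeR R] (fun z => F z.1 z.2).
Proof.
apply: measurable_funM.
  by apply: measurableT_comp; [exact: measurable_expdens|exact: measurable_snd].
apply: (measurableT_comp (L1_measurable Iu)); apply: measurable_funB.
  exact: measurable_fst.
by apply: measurable_funM => //; exact: measurable_snd.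
Qed.

Let L1_uN (s : R) : L1 (fun x => u (x - d * s)).
Proof. exact: L1_shift. Qed.

Let F_norm s : \int[mu]_x `|F x s| <= expdens s * \int[mu]_x `|u x|.
Proof.
rewrite -(Rintegral_shift (- (d * s)) (L1_norm Iu)) -RintegralZl//; last exact: L1_norm.
rewrite le_eqVlt; apply/orP; left; apply/eqP; apply: eq_Rintegral => x _.
by rewrite /F normrM ger0_norm ?expdens_ge0.
Qed.

(** Young's inequality for a probability density. *)
Lemma L1_exp_conv : L1 (exp_conv d u).
Proof.
apply: (L1_Rintegral measurable_F _ _ (g := fun s => expdens s * \int[mu]_x `|u x|)).
- by move=> x; apply: L1_exp_conv_integrand uB; exact: L1_measurable.
- by move=> s; exact: (L1Z _ (L1_uN s)).
- rewrite (_ : (fun s => _) = (fun s => (\int[mu]_x `|u x|) * expdens s)).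
    exact: L1Z (L1_expdens R).
  by apply/funext => s; rewrite mulrC.
- exact: F_norm.
Qed.

(** Integrate first with respect to x: the translation by d s becomes the phase
    w d s, and the remaining integral in s is expdens_cos. *)
Lemma trigT_exp_conv w ph : trigT (exp_conv d u) w ph =
  (trigT u w ph - w * d * trigT u w (ph - pi / 2)) / (1 + (w * d) ^+ 2).
Proof.
have mu_ := L1_measurable Iu.
pose G x s := F x s * cos (w * x + ph).
have L1G1 x : L1 (G x).
  rewrite (_ : G x = (fun s => cos (w * x + ph) * F x s)).
    by apply: L1Z; apply: L1_exp_conv_integrand uB; exact: L1_measurable.
  by apply/funext => s; rewrite /G mulrC.
have L1G2 s : L1 (G ^~ s) by apply: L1_trig; exact: (L1Z _ (L1_uN s)).
transitivity (\int[mu]_x \int[mu]_s G x s).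
  apply: eq_Rintegral => x _; rewrite mulrC -RintegralZl//; last exact: L1_exp_conv_integrand uB.
  by apply: eq_Rintegral => s _; rewrite mulrC.
rewrite (@Rintegral_fubini _ G _ L1G1 L1G2 (fun s => expdens s * \int[mu]_x `|u x|)); first last.
- move=> s; apply: le_trans (F_norm s).
  apply: le_Rintegral => //; [exact: L1_norm|apply: L1_norm; exact: (L1Z _ (L1_uN s))|].
  by move=> x _; rewrite /G normrM ler_piMr// cos_norm_le1.
- rewrite (_ : (fun s => _) = (fun s => (\int[mu]_x `|u x|) * expdens s)).
    exact: L1Z (L1_expdens R).
  by apply/funext => s; rewrite mulrC.
- apply: measurable_funM; first exact: measurable_F.
  apply: (measurableT_comp (measurable_cos_affine w ph)); exact: measurable_fst.
have inner s : \int[mu]_x G x s =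
   trigT u w ph * (expdens s * cos (w * d * s + 0)) -
   trigT u w (ph - pi / 2) * (expdens s * cos (w * d * s + - (pi / 2))).
  rewrite -sin_as_cos addr0.
  transitivity (expdens s * trigT u w (ph + w * d * s)); last first.
    by rewrite trigT_phase//; ring.
  rewrite /trigT -RintegralZl//; last exact: L1_trig.
  rewrite -(@Rintegral_shift _ (G ^~ s) (d * s))//.
  apply: eq_Rintegral => x _; rewrite /G /F addrK -mulrA.
  by congr (_ * (_ * cos _)); ring.
under eq_Rintegral do rewrite inner.
have Ic b : L1 (fun s => expdens s * cos (w * d * s + b)) by apply: L1_trig; exact: L1_expdens.
rewrite RintegralB//; [|exact: L1Z..].
rewrite !RintegralZl//; [|exact: Ic..].
by rewrite !expdens_cos cos0 sin0 cosN sinN cos_pihalf sin_pihalf; ring.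
Qed.
End exp_conv.

End Trig.

(** * Fourier transform of a Gaussian *)

Section GaussTransform.
Variable R : realType.
Notation mu := (@lebesgue_measure R).
Implicit Types (f g u v F : R -> R) (x y a b B K M d s w ph al : R).

Lemma gauss_continuous al : continuous (@gauss R al).
Proof.
by move=> z; apply/differentiable_continuous/derivable1_diffP; have [] := is_derive_gauss al z.
Qed.

(** Compare with the normal density of variance 1 / (2 al).  The integral is used
    below as a normalization, whence the interest in its being nonzero. *)
Lemma gauss_integral al : 0 < al -> L1 (@gauss R al) /\ \int[mu]_x gauss al x != 0.
Proof.
move=> al0; pose s := Num.sqrt (2 * al)^-1.
have s0 : 0 < s by rewrite sqrtr_gt0 invr_gt0 mulr_gt0.
have E : normal_pdf 0 s = (fun x => normal_peak s * gauss al x).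
  rewrite normal_pdfE ?gt_eqF//; apply/funext => x; congr (_ * _).
  rewrite /normal_fun /gauss subr0; congr expR.
  rewrite /s sqr_sqrtr ?invr_ge0 ?mulr_ge0 ?(ltW al0)//.
  by rewrite -mulr_natr; field; rewrite gt_eqF.
have pk := normal_peak_gt0 (lt0r_neq0 s0).
have Ig : L1 (@gauss R al).
  have := integrable_normal_pdf 0 s; rewrite E => /(L1Z (normal_peak s)^-1).
  rewrite /L1; congr (_.-integrable _ _); apply/funext => x /=.
  by rewrite mulrA mulVf ?mul1r// gt_eqF.
split=> //; have : \int[mu]_x normal_pdf 0 s x = 1 by rewrite /Rintegral integral_normal_pdf.
rewrite E RintegralZl// => h; apply/eqP => I0.
by move: h; rewrite I0 mulr0 => /eqP; rewrite eq_sym oner_eq0.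
Qed.

Lemma L1_gauss al : 0 < al -> L1 (@gauss R al).
Proof. by move=> /gauss_integral[]. Qed.

(** Half of the exponent absorbs the factor |x|. *)
Lemma gauss_moment_dominated al x : 0 < al ->
  `|x| * gauss al x <= (1 + 2 / al) * gauss (al / 2) x.
Proof.
move=> al0.
have -> : gauss al x = gauss (al / 2) x * gauss (al / 2) x.
  by rewrite /gauss -expRD; congr expR; field.
rewrite mulrA ler_wpM2r ?expR_ge0// {1}/gauss expRN ler_pdivrMr ?expR_gt0//.
have h : 1 + al / 2 * x ^+ 2 <= expR (al / 2 * x ^+ 2) by apply: expR_ge1Dx.
have i0 : 0 < 2 / al by rewrite divr_gt0.
apply: le_trans (ler_wpM2l _ h); last by rewrite addr_ge0// ltW.
have -> : (1 + 2 / al) * (1 + al / 2 * x ^+ 2) = 1 + 2 / al + al / 2 * x ^+ 2 + x ^+ 2.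
  by field; rewrite gt_eqF.
have : 0 <= al / 2 * x ^+ 2 by rewrite mulr_ge0 ?sqr_ge0// divr_ge0// ltW.
rewrite -(real_normK (num_real x)); set t := al / 2 * _ => t0.
by have := sqr_ge0 (`|x| - 1); have := sqr_ge0 `|x|; rewrite !expr2; lra.
Qed.

Lemma L1_gauss_moment al (h : R -> R) : 0 < al -> measurable_fun setT h ->
  (forall x, `|h x| <= 1) -> L1 (fun x => x * gauss al x * h x).
Proof.
move=> al0 mh h1; apply: (@L1_dominated _ _ (fun x => (1 + 2 / al) * gauss (al / 2) x)).
- apply: measurable_funM => //; apply: measurable_funM => //.
  exact: L1_measurable (L1_gauss al0).
- by apply: L1Z; apply: L1_gauss; rewrite divr_gt0.
- move=> x; rewrite normrM normrM (ger0_norm (expR_ge0 _)).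
  apply: le_trans (gauss_moment_dominated x al0).
  by rewrite ler_piMr// mulr_ge0 ?expR_ge0.
Qed.

Lemma gauss_cvg0 al : 0 < al -> gauss al n%:R @[n --> \oo] --> (0 : R).
Proof.
move=> al0; have [K GK] := gauss_decay al0.
apply: norm_cvg0; apply: (@squeeze_cvgr _ _ _ _ (fun=> 0) (fun n => K * harmonic n)).
- near=> n; rewrite normr_ge0/=; apply: le_trans (GK _) _.
  have K0 : 0 <= K.
    by have := le_trans (normr_ge0 _) (GK 0); rewrite pmulr_lge0// decay_gt0.
  have p2 : 0 < (1 + n%:R) * (2 + n%:R) :> R by rewrite mulr_gt0// ltr_pwDl.
  rewrite ler_wpM2l// /decay /harmonic/= normr_nat lef_pV2 ?posrE ?ltr0n//.
  by have := ler0n R n; rewrite -[n.+1]add1n natrD; nra.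
- exact: cvg_cst.
- rewrite -[X in _ --> X](mulr0 K); apply: cvgM; [exact: cvg_cst|exact: cvg_harmonic].
Unshelve. all: by end_near. Qed.

Section transform.
Variables (al ph : R).
Hypothesis al0 : 0 < al.

Let m_sin w : measurable_fun setT (fun x => sin (w * x + ph)).
Proof. by apply: continuous_measurable_fun; exact: continuous_sin_affine. Qed.

Let I_xsin w : L1 (fun x => x * gauss al x * sin (w * x + ph)).
Proof. by apply: (L1_gauss_moment al0 (m_sin w)) => x; exact: sin_norm_le1. Qed.

(** Integration by parts: the integral of the derivative of
    gauss x * sin (w x + ph) is zero. *)
Lemma gauss_moment_sin w :
  \int[mu]_x (x * gauss al x * sin (w * x + ph)) = w / (2 * al) * trigT (gauss al) w ph.
Proof.
have a2 : 2 * al != 0 by rewrite mulf_neq0 ?gt_eqF.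
have Ic := L1_trig w ph (L1_gauss al0).
pose F x := gauss al x * sin (w * x + ph).
have dF x : is_derive x 1 F (- (2 * al) * (x * gauss al x * sin (w * x + ph)) +
    w * (gauss al x * cos (w * x + ph))).
  have d1 := is_derive_gauss al x.
  have d2 : is_derive x 1 (fun x => sin (w * x + ph)) (cos (w * x + ph) * w).
    exact: (is_derive_comp_affine (is_derive_sin _)).
  by rewrite /F; apply: is_derive_eq; rewrite /GRing.scale/=; ring.
have cvgF (e : nat -> R) : (forall n, gauss al (e n) = gauss al n%:R) ->
    F (e n) @[n --> \oo] --> (0 : R).
  move=> eE; apply: norm_cvg0.
  apply: (@squeeze_cvgr _ _ _ _ (fun=> 0) (fun n => gauss al n%:R)).
  - near=> n; rewrite normr_ge0/= /F normrM eE ger0_norm ?expR_ge0//.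
    by rewrite ler_piMr ?expR_ge0// sin_norm_le1.
  - exact: cvg_cst.
  - exact: gauss_cvg0.
have c1 : continuous (fun x => - (2 * al) * (x * gauss al x * sin (w * x + ph)) +
    w * (gauss al x * cos (w * x + ph))).
  move=> x; apply: cvgD; (apply: cvgM; first exact: cvg_cst); apply: cvgM.
  - by apply: cvgM; [exact: cvg_id|exact: gauss_continuous].
  - exact: continuous_sin_affine.
  - exact: gauss_continuous.
  - exact: continuous_cos_affine.
have := @Rintegral_deriv0 _ _ _ (L1D (L1Z (- (2 * al)) (I_xsin w)) (L1Z w Ic)) c1 dF.
rewrite RintegralD//; [|exact: L1Z..].
rewrite !RintegralZl//; [move=> H|exact: I_xsin..].
have {H} : - (2 * al) * \int[mu]_x (x * gauss al x * sin (w * x + ph)) +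
    w * trigT (gauss al) w ph = 0.
  apply: H; apply: cvgF => n //.
  by rewrite /gauss sqrrN.
move=> /eqP; rewrite mulNr addrC subr_eq0 => /eqP H.
by apply: (mulfI a2); rewrite -H; field; rewrite gt_eqF.
Unshelve. all: by end_near. Qed.

Lemma is_derive_trigT_gauss w :
  is_derive w 1 (fun w => trigT (gauss al) w ph) (- (w / (2 * al) * trigT (gauss al) w ph)).
Proof.
pose f w x := gauss al x * cos (w * x + ph).
have df w' x : is_derive w' 1 (f ^~ x) (- (x * gauss al x * sin (w' * x + ph))).
  have d2 : is_derive w' 1 (fun w => cos (w * x + ph)) (- sin (w' * x + ph) * x).
    rewrite (_ : (fun w => _) = (fun w => cos (x * w + ph))).
      by rewrite (mulrC w'); exact: (is_derive_comp_affine (is_derive_cos _)).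
    by apply/funext => z; rewrite mulrC.
  by rewrite /f; apply: is_derive_eq; rewrite /GRing.scale/=; ring.
have I0 : `]w - 1, w + 1[%classic w by rewrite /= in_itv/=; apply/andP; split; lra.
pose G x := (1 + 2 / al) * gauss (al / 2) x.
have p1 w' x : partial1of2 f w' x = - (x * gauss al x * sin (w' * x + ph)).
  by rewrite partial1of2E; have [_ ->] := df w' x.
have h1 w' : `]w - 1, w + 1[%classic w' -> mu.-integrable setT (EFin \o f w').
  by move=> _; apply: L1_trig; exact: L1_gauss.
have h2 w' x : `]w - 1, w + 1[%classic w' -> setT x -> derivable (f ^~ x) w' 1.
  by move=> _ _; have [] := df w' x.
have h3 x : 0 <= G x by rewrite mulr_ge0 ?expR_ge0// addr_ge0// divr_ge0// ltW.
have h4 : mu.-integrable setT (EFin \o G) by apply: L1Z; apply: L1_gauss; rewrite divr_gt0.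
have h5 w' x : `]w - 1, w + 1[%classic w' -> setT x -> `|partial1of2 f w' x| <= G x.
  move=> _ _; rewrite p1 normrN normrM normrM (ger0_norm (expR_ge0 _)).
  apply: le_trans (gauss_moment_dominated x al0).
  by rewrite ler_piMr ?mulr_ge0 ?expR_ge0// sin_norm_le1.
apply: DeriveDef; first exact: (derivable_under_integral measurableT I0 h1 h2 h3 h4 h5).
rewrite -derive1E (differentiation_under_integral measurableT I0 h1 h2 h3 h4 h5).
rewrite -gauss_moment_sin -[RHS]mulN1r -RintegralZl//; last exact: I_xsin.
by apply: eq_Rintegral => x _; rewrite p1 mulN1r.
Qed.

(** By differentiation under the integral sign and gauss_moment_sin, the transform
    satisfies J' = - w / (2 al) J. *)
Lemma trigT_gauss w : trigT (gauss al) w ph =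
  expR (- (w ^+ 2 / (4 * al))) * (cos ph * \int[mu]_x gauss al x).
Proof.
pose H w := expR (w ^+ 2 / (4 * al)) * trigT (gauss al) w ph.
have dH w' : is_derive w' 1 H 0.
  have d1 := is_derive_trigT_gauss w'.
  have d2 : is_derive w' 1 (fun w => expR (w ^+ 2 / (4 * al)))
      (expR (w' ^+ 2 / (4 * al)) * (w' / (2 * al))).
    apply: (@is_derive1_comp _ expR (fun w => w ^+ 2 / (4 * al))).
    apply: is_derive_eq; rewrite /GRing.scale/=.
    by field; rewrite gt_eqF.
  by rewrite /H; apply: is_derive_eq; rewrite /GRing.scale/=; ring.
have := is_derive_0_is_cst w 0 dH.
rewrite /H expr0n/= mul0r expR0 mul1r => E.
have -> : cos ph * \int[mu]_x gauss al x = trigT (gauss al) 0 ph.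
  rewrite -RintegralZl//; last exact: L1_gauss.
  by apply: eq_Rintegral => x _; rewrite mul0r add0r mulrC.
by rewrite -E mulrA -expRD addNr expR0 mul1r.
Qed.
End transform.

End GaussTransform.

(** * Injectivity of the Fourier transform *)

Section Uniqueness.
Variable R : realType.
Notation mu := (@lebesgue_measure R).
Implicit Types (f g u v F : R -> R) (x y a b B K M d s w ph al e : R).

(** The Poisson kernel 1 / (1 + t^2) is itself the average of cos (t s) for the
    exponential density, so integrating v against it is an average of values of
    the transform of v. *)
Lemma trigT0_poisson v y e : L1 v -> (forall w ph, trigT v w ph = 0) ->
  \int[mu]_x (v x * (1 + ((x - y) / e) ^+ 2)^-1) = 0.
Proof.
move=> Iv v0; have mv := L1_measurable Iv.
pose F x s := v x * (expdens s * cos ((x - y) / e * s)).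
have cb a s : `|expdens s * cos (a * s)| <= expdens s.
  by rewrite normrM (ger0_norm (expdens_ge0 _)) ler_piMr ?expdens_ge0// cos_norm_le1.
have mc a : measurable_fun setT (fun s => cos (a * s)).
  by have := measurable_cos_affine a 0; under eq_fun do rewrite addr0.
have Ic a : L1 (fun s => expdens s * cos (a * s)).
  apply: L1_dominated (L1_expdens R) (cb a).
  by apply: measurable_funM; [exact: measurable_expdens|exact: mc].
have FE x s : F x s = expdens s * (v x * cos (s / e * x + - (s / e * y))).
  rewrite /F mulrCA; congr (_ * (_ * cos _)); ring.
transitivity (\int[mu]_x \int[mu]_s F x s).
  apply: eq_Rintegral => x _; rewrite RintegralZl//; last exact: Ic.
  congr (_ * _); have := expdens_cos ((x - y) / e) 0.
  under eq_Rintegral do rewrite addr0.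
  by move=> ->; rewrite cos0 sin0 mulr0 subr0 div1r.
rewrite (@Rintegral_fubini _ F _ _ _ (fun s => (\int[mu]_x `|v x|) * expdens s)).
- rewrite -(mul0r (\int[mu]_s expdens s)) -RintegralZl//; last exact: L1_expdens.
  apply: eq_Rintegral => s _; rewrite mul0r.
  under eq_Rintegral do rewrite FE.
  rewrite RintegralZl//; last exact: L1_trig.
  by have := v0 (s / e) (- (s / e * y)); rewrite /trigT => ->; rewrite mulr0.
- apply: measurable_funM; first by apply: measurableT_comp; [exact: mv|exact: measurable_fst].
  apply: measurable_funM; first by apply: measurableT_comp; [exact: measurable_expdens|exact: measurable_snd].
  apply: (measurableT_comp (continuous_measurable_fun (@continuous_cos R))).
  apply: measurable_funM; last exact: measurable_snd.
  by apply: measurable_funM => //; apply: measurable_funB => //; exact: measurable_fst.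
- by move=> x; apply: L1Z; exact: Ic.
- move=> s; rewrite (_ : F ^~ s = (fun x => expdens s * (v x * cos (s / e * x + - (s / e * y))))).
    by apply: L1Z; exact: L1_trig.
  by apply/funext => x; rewrite FE.
- exact: L1Z (L1_expdens R).
- move=> s; rewrite mulrC -RintegralZl//; last exact: L1_norm.
  have Is : L1 (F ^~ s).
    rewrite (_ : F ^~ s = (fun x => expdens s * (v x * cos (s / e * x + - (s / e * y))))).
      by apply: L1Z; exact: L1_trig.
    by apply/funext => x; rewrite FE.
  apply: le_Rintegral => //; [exact: L1_norm|by apply: L1Z; exact: L1_norm|].
  move=> x _; rewrite FE normrM (ger0_norm (expdens_ge0 _)) ler_wpM2l ?expdens_ge0//.
  by rewrite normrM ler_piMr// cos_norm_le1.
Qed.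

Let kernel_le1 x y e : (1 + ((x - y) / e) ^+ 2)^-1 <= 1.
Proof. by rewrite invf_le1 ?lerDl ?sqr_ge0// ltr_pwDl// sqr_ge0. Qed.

Let kernel_ge0 x y e : 0 <= (1 + ((x - y) / e) ^+ 2)^-1.
Proof. by rewrite invr_ge0 addr_ge0// sqr_ge0. Qed.

(** If v y were positive, the Poisson integrals at y would be positive for small
    e: the kernel has mass of order e near y, where v >= v y / 2, and is at most
    (e / eta)^2 at distance eta, so the rest contributes O(e^2). *)
Let trigT0_npos v y : L1 v -> continuous v -> (forall w ph, trigT v w ph = 0) -> v y <= 0.
Proof.
move=> Iv cv v0; rewrite leNgt; apply/negP => vy.
pose c := v y / 2; have c0 : 0 < c by rewrite divr_gt0.
have [eta /= eta0 near_y] : exists2 eta, 0 < eta & forall x, `|x - y| < eta -> c <= v x.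
  have /cvgrPdist_lt/(_ _ c0)/nbhs_ballP[eta /= eta0 H] := cv y.
  exists eta => // x xy; have := H x; rewrite /ball/= distrC => /(_ xy).
  by rewrite ltr_distlC /c => /andP[+ _]; lra.
pose V := \int[mu]_x `|v x|.
have V0 : 0 <= V by apply: Rintegral_ge0.
have [e [e0 e1 e2]] : exists e, [/\ 0 < e, e < eta & e * V < c * eta ^+ 2].
  exists (Num.min (eta / 2) (c * eta ^+ 2 / (V + 1))).
  have V1 : 0 < V + 1 by lra.
  have ce : 0 < c * eta ^+ 2 by rewrite mulr_gt0 ?exprn_gt0.
  split.
  - by rewrite lt_min !divr_gt0.
  - by rewrite gt_min; apply/orP; left; lra.
  - apply: (@le_lt_trans _ _ (c * eta ^+ 2 / (V + 1) * V)).
      by rewrite ler_wpM2r// ge_min lexx orbT.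
    by rewrite mulrAC ltr_pdivrMr// ltr_pM2l// ltrDl.
have := trigT0_poisson y e Iv v0.
pose low x := ((fun=> c / 2) \_ `[y - e, y + e]%classic) x - (e / eta) ^+ 2 * `|v x|.
have Ilow1 : L1 ((fun=> c / 2) \_ `[y - e, y + e]%classic).
  rewrite /L1 -restrict_EFin; apply/(integrable_mkcond _ _).1 => //.
  by apply: continuous_integrable_itv => ?; exact: cvg_cst.
have Ilow : L1 low.
  apply: L1D => //; apply: L1N; apply: L1Z; exact: L1_norm.
have IK : L1 (fun x => v x * (1 + ((x - y) / e) ^+ 2)^-1).
  apply: (L1_mul_bounded (B := 1) Iv) => [|x]; last by rewrite ger0_norm ?kernel_le1 ?kernel_ge0.
  apply: measurable_funTS; apply: continuous_measurable_fun => x; apply: cvgV.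
    by rewrite gt_eqF// ltr_pwDl// sqr_ge0.
  apply: cvgD; first exact: cvg_cst.
  by apply: cvgM; (apply: cvgM; [apply: cvgB; [exact: cvg_id|exact: cvg_cst]|exact: cvg_cst]).
have : \int[mu]_x low x <= \int[mu]_x (v x * (1 + ((x - y) / e) ^+ 2)^-1).
  apply: le_Rintegral => // x _; rewrite /low.
  set K := (1 + ((x - y) / e) ^+ 2)^-1.
  have K0 : 0 <= K by exact: kernel_ge0.
  have ab : 0 <= (e / eta) ^+ 2 * `|v x| by rewrite mulr_ge0// sqr_ge0.
  have [xy|xy] := ltP `|x - y| eta.
    have cx := near_y x xy.
    apply: (@le_trans _ _ (c * K)); last by rewrite ler_wpM2r.
    apply: (@le_trans _ _ (((fun=> c / 2) \_ `[y - e, y + e]%classic) x)); first by lra.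
    rewrite patchE; case: ifPn => [|_]; last by rewrite mulr_ge0// ltW.
    rewrite inE/= in_itv/= -ler_distlC distrC => xe.
    rewrite ler_pM2l// lef_pV2 ?posrE//; last by rewrite ltr_pwDl// sqr_ge0.
    suff : ((x - y) / e) ^+ 2 <= 1 by lra.
    rewrite -(real_normK (num_real _)) expr_le1// normrM normfV (gtr0_norm e0).
    by rewrite ler_pdivrMr// mul1r.
  rewrite patchE memNset/=; last first.
    rewrite in_itv/= -ler_distlC distrC => xe; move: (le_trans xy xe); lra.
  rewrite sub0r.
  have KE : K <= (e / eta) ^+ 2.
    rewrite -[leRHS]invrK lef_pV2 ?posrE//; last 2 first.
    - by rewrite ltr_pwDl// sqr_ge0.
    - by rewrite invr_gt0 exprn_gt0// divr_gt0.
    rewrite -exprVn invf_div; apply: (@le_trans _ _ (((x - y) / e) ^+ 2)); last by lra.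
    rewrite -[leRHS](real_normK (num_real _)) lerXn2r ?nnegrE ?divr_ge0 ?(ltW e0) ?(ltW eta0)//.
    by rewrite normrM normfV (gtr0_norm e0) ler_pM2r// invr_gt0.
  rewrite lerNl -mulNr; apply: (@le_trans _ _ (`|v x| * K)).
    by rewrite ler_wpM2r// -normrN ler_norm.
  by rewrite mulrC ler_wpM2r.
move=> /[swap] ->; rewrite leNgt => /negP; apply.
rewrite RintegralB//; last first.
  by apply: L1Z; exact: L1_norm.
rewrite RintegralZl//; last exact: L1_norm.
have -> : \int[mu]_x ((fun=> c / 2) \_ `[y - e, y + e]%classic) x = c / 2 * (y + e - (y - e)).
  rewrite -Rintegral_mkcond Rintegral_cst; last exact: measurable_itv.
  rewrite /= lebesgue_measure_itv/= lte_fin ifT//; lra.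
rewrite -/V subr_gt0.
have -> : c / 2 * (y + e - (y - e)) = c * e by field.
rewrite expr_div_n mulrAC ltr_pdivrMr ?exprn_gt0//.
have : e * (e * V) < e * (c * eta ^+ 2) by rewrite ltr_pM2l.
rewrite !expr2; lra.
Qed.

Lemma trigT_unique u v : L1 u -> L1 v -> continuous u -> continuous v ->
  (forall w ph, trigT u w ph = trigT v w ph) -> u = v.
Proof.
move=> Iu Iv cu cv uv.
have sub f g : L1 f -> L1 g -> continuous f -> continuous g ->
    (forall w ph, trigT f w ph = trigT g w ph) -> forall y, f y <= g y.
  move=> If Ig cf cg fg y; rewrite -subr_le0.
  apply: (@trigT0_npos (fun x => f x - g x)).
  - exact: L1D If (L1N Ig).
  - by move=> x; apply: cvgB; [exact: cf|exact: cg].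
  - move=> w ph; rewrite /trigT; under eq_Rintegral do rewrite mulrBl.
    rewrite RintegralB//; [|exact: L1_trig..].
    by apply/eqP; rewrite subr_eq0; apply/eqP; exact: fg.
by apply/funext => y; apply/eqP; rewrite eq_le !sub.
Qed.

End Uniqueness.

(** * Iterated exponential convolutions *)

Section IteratedConv.
Variable R : realType.
Notation mu := (@lebesgue_measure R).
Implicit Types (f g u v F : R -> R) (x y a b B K M d s w ph al e : R) (ds : seq R).

Lemma bounded_lipD u v : bounded_lip u -> bounded_lip v -> bounded_lip (fun x => u x + v x).
Proof.
move=> [[B uB] [K uK]] [[C vC] [L vL]]; split.
  by exists (B + C) => x; rewrite (le_trans (ler_normD _ _))// lerD.
exists (K + L) => x y; rewrite opprD addrACA (le_trans (ler_normD _ _))//.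
by rewrite mulrDl lerD.
Qed.

Lemma bounded_lipZ r u : bounded_lip u -> bounded_lip (fun x => r * u x).
Proof.
move=> [[B uB] [K uK]]; split.
  by exists (`|r| * B) => x; rewrite normrM ler_wpM2l.
by exists (`|r| * K) => x y; rewrite -mulrBr normrM -mulrA ler_wpM2l.
Qed.

Lemma bounded_lip_translate u a : bounded_lip u -> bounded_lip (fun x => u (x - a)).
Proof.
move=> [[B uB] [K uK]]; split; first by exists B.
exists K => x y; apply: le_trans (uK _ _) _.
by rewrite (_ : x - a - (y - a) = x - y)//; ring.
Qed.

Lemma bounded_lip_cst r : bounded_lip (fun=> r : R).
Proof.
by split; [exists (`|r|) | exists 0 => x y; rewrite subrr normr0 mul0r].
Qed.

(** At distance larger than 1 the Lipschitz estimate follows from boundedness. *)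
Lemma bounded_lip_local u : (exists B, forall x, `|u x| <= B) ->
  (exists K, forall x y, `|x - y| <= 1 -> `|u x - u y| <= K * `|x - y|) -> bounded_lip u.
Proof.
move=> [B uB] [K uK]; split; first by exists B.
have B0 : 0 <= B by rewrite (le_trans _ (uB 0)).
exists (Num.max K (B + B)) => x y; have [xy|xy] := leP `|x - y| 1.
  by apply: le_trans (uK _ _ xy) _; rewrite ler_wpM2r// le_max lexx.
apply: le_trans (ler_normB _ _) _; apply: le_trans (lerD (uB x) (uB y)) _.
apply: (@le_trans _ _ ((B + B) * `|x - y|)).
  by rewrite ler_peMr ?addr_ge0// ltW.
by rewrite ler_wpM2r// le_max lexx orbT.
Qed.

Lemma lattice_partialS c u n x : lattice_partial c u n.+1 x = lattice_partial c u n x +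
  (c (Posz n) * u (x - (Posz n)%:~R) + c (Negz n) * u (x - (Negz n)%:~R)).
Proof. by rewrite /lattice_partial /bipartial /series/= big_nat_recr. Qed.

Lemma lattice_partial0 c u x : lattice_partial c u 0 x = 0.
Proof. by rewrite /lattice_partial /bipartial /series/= big_nil. Qed.

Lemma bounded_lip_lattice_partial c u n : bounded_lip u -> bounded_lip (lattice_partial c u n).
Proof.
move=> bu; elim: n => [|n IH].
  by rewrite (_ : lattice_partial _ _ _ = fun=> 0); [exact: bounded_lip_cst|apply/funext => x; exact: lattice_partial0].
rewrite (_ : lattice_partial _ _ _ = fun x => lattice_partial c u n x +
  (c (Posz n) * u (x - (Posz n)%:~R) + c (Negz n) * u (x - (Negz n)%:~R))); last first.
  by apply/funext => x; exact: lattice_partialS.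
by apply: bounded_lipD => //; apply: bounded_lipD; apply: bounded_lipZ; exact: bounded_lip_translate.
Qed.

Lemma exp_conv_add d u v x : bounded_lip u -> bounded_lip v ->
  exp_conv d (fun x => u x + v x) x = exp_conv d u x + exp_conv d v x.
Proof.
move=> bu bv; have [[B uB] _] := bu; have [[C vC] _] := bv.
by apply: exp_convD uB vC; exact: bounded_lip_measurable.
Qed.

Lemma exp_conv_scale d u r x : bounded_lip u ->
  exp_conv d (fun x => r * u x) x = r * exp_conv d u x.
Proof.
move=> bu; have [[B uB] _] := bu.
by apply: exp_convZ uB; exact: bounded_lip_measurable.
Qed.

Lemma exp_conv_lattice_partial d c u n : bounded_lip u ->
  exp_conv d (lattice_partial c u n) = lattice_partial c (exp_conv d u) n.
Proof.
move=> bu; elim: n => [|n IH]; apply/funext => x.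
  rewrite lattice_partial0 /exp_conv.
  by under eq_Rintegral do rewrite lattice_partial0 mulr0; rewrite Rintegral_cst// mul0r.
rewrite lattice_partialS -IH.
have bt k := bounded_lipZ (c k) (bounded_lip_translate k%:~R bu).
rewrite (_ : lattice_partial _ _ _ = fun x => lattice_partial c u n x +
  (c (Posz n) * u (x - (Posz n)%:~R) + c (Negz n) * u (x - (Negz n)%:~R))); last first.
  by apply/funext => y; exact: lattice_partialS.
rewrite exp_conv_add; [|exact: bounded_lip_lattice_partial|exact: (bounded_lipD (bt _) (bt _))].
rewrite exp_conv_add; [|exact: (bt (Posz n))|exact: (bt (Negz n))].
by rewrite !exp_conv_scale ?exp_conv_translate//; exact: bounded_lip_translate.
Qed.

Definition exp_convs ds u := foldr (@exp_conv R) u ds.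

Lemma bounded_lip_exp_convs ds u : bounded_lip u -> bounded_lip (exp_convs ds u).
Proof. by move=> bu; elim: ds => //= d ds IH; exact: exp_conv_bounded_lip. Qed.

Lemma exp_convs_bounded ds u B : bounded_lip u -> (forall x, `|u x| <= B) ->
  forall x, `|exp_convs ds u x| <= B.
Proof.
move=> bu uB; elim: ds => //= d ds IH; apply: exp_conv_bounded => //.
by apply: bounded_lip_measurable; exact: bounded_lip_exp_convs.
Qed.

Lemma L1_exp_convs ds u : bounded_lip u -> L1 u -> L1 (exp_convs ds u).
Proof.
move=> bu Iu; elim: ds => //= d ds IH.
by have [[B uB] _] := bounded_lip_exp_convs ds bu; exact: L1_exp_conv uB.
Qed.

Lemma exp_convs_cvg ds (un : nat -> R -> R) u B :
  (forall n, bounded_lip (un n)) -> (forall n y, `|un n y| <= B) ->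
  (forall y, un ^~ y @ \oo --> u y) ->
  forall x, exp_convs ds (un n) x @[n --> \oo] --> exp_convs ds u x.
Proof.
move=> bun unB unu; elim: ds => //= d ds IH x.
apply: (@exp_conv_cvg _ _ (fun n => exp_convs ds (un n)) _ B).
- by move=> n; apply: bounded_lip_measurable; exact: bounded_lip_exp_convs.
- by move=> n; exact: exp_convs_bounded.
- exact: IH.
Qed.

Lemma exp_convs_lattice_partial ds c u n : bounded_lip u ->
  exp_convs ds (lattice_partial c u n) = lattice_partial c (exp_convs ds u) n.
Proof.
move=> bu; elim: ds => //= d ds ->; rewrite exp_conv_lattice_partial//.
exact: bounded_lip_exp_convs.
Qed.

Lemma exp_convs_scale ds r u : bounded_lip u ->
  exp_convs ds (fun x => r * u x) = (fun x => r * exp_convs ds u x).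
Proof.
move=> bu; elim: ds => //= d ds ->; apply/funext => x.
by apply: exp_conv_scale; exact: bounded_lip_exp_convs.
Qed.

Lemma bounded_lip_gauss al : 0 < al -> bounded_lip (@gauss R al).
Proof.
move=> al0; have [K GK] := gauss_decay al0; have [L GL] := gauss_lipschitz al0.
have K0 : 0 <= K.
  by have := le_trans (normr_ge0 _) (GK 0); rewrite pmulr_lge0// decay_gt0.
have L0 : 0 <= L.
  have /GL : `|0 - 1 : R| <= 1 by rewrite sub0r normrN normr1.
  rewrite sub0r normrN1 mulr1 => /(le_trans (normr_ge0 _)).
  by rewrite pmulr_lge0// decay_gt0.
apply: bounded_lip_local.
  by exists K => x; apply: le_trans (GK x) _; rewrite ler_piMr// decay_le1.
exists L => x y xy; apply: le_trans (GL x y xy) _.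
by rewrite ler_wpM2r// ler_piMr// decay_le1.
Qed.

Lemma bounded_lip_lattice_gauss al c M : 0 < al -> (forall k, `|c k| <= M) ->
  bounded_lip (lattice_sum c (@gauss R al)).
Proof.
move=> al0 cM; have [K GK] := gauss_decay al0; have [L GL] := gauss_lipschitz al0.
apply: bounded_lip_local.
  by exists (M * K * 2) => x; exact: lattice_sum_bounded.
by exists (M * L * 2) => x y; exact: (lattice_sum_lipschitz cM GK GL).
Qed.

(** Convolutions commute with the partial lattice sums, and dominated convergence
    applies at each of the successive convolutions. *)
Lemma exp_convs_lattice_cvg ds al c M x : 0 < al -> (forall k, `|c k| <= M) ->
  lattice_partial c (exp_convs ds (@gauss R al)) n x @[n --> \oo] -->
  exp_convs ds (lattice_sum c (gauss al)) x.
Proof.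
move=> al0 cM; have [K GK] := gauss_decay al0; have bg := bounded_lip_gauss al0.
under eq_fun do rewrite -exp_convs_lattice_partial//.
apply: (@exp_convs_cvg ds _ _ (M * K * 2)).
- by move=> n; exact: bounded_lip_lattice_partial.
- by move=> n y; exact: lattice_partial_bounded.
- by move=> y; exact: lattice_sum_cvg.
Qed.

Lemma exp_convs_lattice_bounded ds al c M : 0 < al -> (forall k, `|c k| <= M) ->
  exists B, forall n x, `|lattice_partial c (exp_convs ds (@gauss R al)) n x| <= B.
Proof.
move=> al0 cM; have [K GK] := gauss_decay al0; have bg := bounded_lip_gauss al0.
exists (M * K * 2) => n x; rewrite -exp_convs_lattice_partial//.
apply: exp_convs_bounded; first exact: bounded_lip_lattice_partial.
by move=> y; exact: lattice_partial_bounded.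
Qed.

End IteratedConv.

(** * The generator as an averaged Gaussian *)

Section ComplexTools.
Variable R : realType.
Notation mu := (@lebesgue_measure R).
Local Open Scope complex_scope.
Implicit Types (g : R -> R[i]).

Lemma normc_Re (z : R[i]) : `|complex.Re z| <= ComplexField.Normc.normc z.
Proof.
case: z => a b /=; rewrite -sqrtr_sqr ler_sqrt ?addr_ge0 ?sqr_ge0//.
by rewrite lerDl sqr_ge0.
Qed.

Lemma normc_Im (z : R[i]) : `|complex.Im z| <= ComplexField.Normc.normc z.
Proof.
case: z => a b /=; rewrite -sqrtr_sqr ler_sqrt ?addr_ge0 ?sqr_ge0//.
by rewrite lerDr sqr_ge0.
Qed.

Lemma complex_L1 g : complex_Lp 1%:E g ->
  L1 (fun x => complex.Re (g x)) /\ L1 (fun x => complex.Im (g x)).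
Proof.
move=> [mr mi]; rewrite /finite_norm Lnorm1 => gfin.
have mn : measurable_fun setT (fun x => ComplexField.Normc.normc (g x)).
  rewrite (_ : (fun x => _) = (fun x => Num.sqrt (complex.Re (g x) ^+ 2 + complex.Im (g x) ^+ 2))).
    apply: (measurableT_comp (continuous_measurable_fun (@sqrt_continuous R))).
    by apply: measurable_funD; exact: measurable_funX.
  by apply/funext => x; case: (g x).
have In : L1 (fun x => ComplexField.Normc.normc (g x)).
  by apply/integrableP; split => //; exact/measurable_EFinP.
split; [apply: L1_dominated mr In _|apply: L1_dominated mi In _] => x.
  exact: normc_Re.
exact: normc_Im.
Qed.

Lemma Re_cvg (T : Type) (F : set_system T) {FF : Filter F} (f : T -> R[i]) (l : R[i]) :
  (f : T -> R[i]^o) @ F --> (l : R[i]^o) -> complex.Re (f x) @[x --> F] --> complex.Re l.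
Proof.
move=> fl; apply/cvgrPdist_lt => e e0.
have e0' : (0 : R[i]) < e%:C by rewrite ltcR.
move/cvgrPdist_lt : fl => /(_ _ e0'); apply: filterS => x.
rewrite normc_def ltcR; apply: le_lt_trans.
by case: l (f x) => a b [c d] /=; rewrite -sqrtr_sqr ler_sqrt ?addr_ge0 ?sqr_ge0// lerDl sqr_ge0.
Qed.

Lemma Im_cvg (T : Type) (F : set_system T) {FF : Filter F} (f : T -> R[i]) (l : R[i]) :
  (f : T -> R[i]^o) @ F --> (l : R[i]^o) -> complex.Im (f x) @[x --> F] --> complex.Im l.
Proof.
move=> fl; apply/cvgrPdist_lt => e e0.
have e0' : (0 : R[i]) < e%:C by rewrite ltcR.
move/cvgrPdist_lt : fl => /(_ _ e0'); apply: filterS => x.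
rewrite normc_def ltcR; apply: le_lt_trans.
by case: l (f x) => a b [c d] /=; rewrite -sqrtr_sqr ler_sqrt ?addr_ge0 ?sqr_ge0// lerDr sqr_ge0.
Qed.

Lemma Re_continuous g : continuous (g : R -> R[i]^o) -> continuous (fun x => complex.Re (g x)).
Proof. by move=> cg x; exact: (Re_cvg (cg x)). Qed.

Lemma Im_continuous g : continuous (g : R -> R[i]^o) -> continuous (fun x => complex.Im (g x)).
Proof. by move=> cg x; exact: (Im_cvg (cg x)). Qed.

(** The Fourier integral of u at frequency w / (2 pi). *)
Definition trig_pair (u : R -> R) w : R[i] := trigT u w 0 -i* trigT u w (- (pi / 2)).

Lemma trig_pair_exp_conv u B d w : L1 u -> (forall x, `|u x| <= B) ->
  trig_pair (exp_conv d u) w = trig_pair u w * (1 + 'i * (d * w)%:C)^-1.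
Proof.
move=> Iu uB.
have p0 : 0 < 1 + (w * d) ^+ 2 by rewrite ltr_pwDl// sqr_ge0.
have nz : (1 + 'i * (d * w)%:C : R[i]) != 0.
  by rewrite eq_complex /= !(mul0r, mulr0, subr0, addr0, mul1r) oner_eq0.
apply: (mulIf nz); rewrite mulfVK//.
rewrite /trig_pair !(trigT_exp_conv d Iu uB).
have -> : - (pi / 2) - pi / 2 = 0 + - pi :> R by rewrite -opprD -splitr add0r.
rewrite (trigT_phase w 0 (- pi) Iu) cosN sinN cospi sinpi sub0r.
set T0 := trigT u w 0; set T1 := trigT u w _.
rewrite [d * w]mulrC; move: p0; set a := w * d => p0.
apply/eqP; rewrite eq_complex /=; apply/andP; split; apply/eqP.
  transitivity (T0 * (1 + a ^+ 2) / (1 + a ^+ 2)); [ring|by rewrite mulfK// gt_eqF].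
transitivity (- T1 * (1 + a ^+ 2) / (1 + a ^+ 2)); [ring|by rewrite mulfK// gt_eqF].
Qed.

Lemma trig_pair_exp_convs u ds w : L1 u -> bounded_lip u ->
  trig_pair (exp_convs ds u) w = trig_pair u w * \prod_(d <- ds) (1 + 'i * (d * w)%:C)^-1.
Proof.
move=> Iu bu; elim: ds => [|d ds IH]; first by rewrite big_nil mulr1.
have [[B uB] _] := bounded_lip_exp_convs ds bu.
rewrite big_cons /= (trig_pair_exp_conv _ _ (L1_exp_convs ds bu Iu) uB) IH -mulrA.
by congr (_ * _); rewrite mulrC.
Qed.

Lemma trig_pair_unique u v : L1 u -> L1 v -> continuous u -> continuous v ->
  (forall w, trig_pair u w = trig_pair v w) -> u = v.
Proof.
move=> Iu Iv cu cv uv; apply: trigT_unique => // w ph.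
rewrite -[ph]add0r (trigT_phase w 0 ph Iu) (trigT_phase w 0 ph Iv) sub0r.
by have [-> /oppr_inj ->] := uv w.
Qed.

Lemma trigTN (u : R -> R) (w : R) : L1 u -> trigT u (- w) 0 = trigT u w 0 /\
  trigT u (- w) (- (pi / 2)) = - trigT u w (- (pi / 2)).
Proof.
move=> Iu; split.
  by apply: eq_Rintegral => x _; rewrite !addr0 mulNr cosN.
rewrite -[RHS]mulN1r -RintegralZl//; last exact: L1_trig.
by apply: eq_Rintegral => x _; rewrite -!sin_as_cos mulNr sinN mulN1r mulrN.
Qed.

(** g is complex, so its transform mixes the transforms of its real and imaginary
    parts; the parity in xi will separate them. *)
Lemma fourier_parts (g : R -> R[i]) (w xi : R) : complex_Lp 1%:E g -> w = 2 * pi * xi ->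
  fourier g xi = (trigT (fun x => complex.Re (g x)) w 0 + trigT (fun x => complex.Im (g x)) w (- (pi / 2)))
   +i* (trigT (fun x => complex.Im (g x)) w 0 - trigT (fun x => complex.Re (g x)) w (- (pi / 2))).
Proof.
move=> /complex_L1[Ir Ii] ->.
rewrite /fourier /complex_integral /trigT; congr (_ +i* _).
  rewrite -RintegralD//; [|exact: L1_trig..].
  apply: eq_Rintegral => x _; rewrite addr0 -sin_as_cos /expi.
  case: (g x) => a b /=; rewrite sinN cosN mulrN opprK.
  by congr (_ * cos _ + _ * sin _); ring.
rewrite -RintegralB//; [|exact: L1_trig..].
apply: eq_Rintegral => x _; rewrite addr0 -sin_as_cos /expi.
case: (g x) => a b /=; rewrite sinN cosN mulrN addrC.
by congr (_ * cos _ - _ * sin _); ring.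
Qed.

(** The iterated convolution v has the same transform as g.  As v is real, comparing
    the frequencies w and - w shows that the imaginary part of g has transform 0
    and that its real part has the transform of v; conclude by injectivity. *)
Lemma gaussian_type_tp_exp_convs g : gaussian_type_tp g ->
  exists (al A : R) (ds : seq R), [/\ 0 < al,
    (forall x, complex.Re (g x) = exp_convs ds (fun x => A * gauss al x) x) &
    (forall x, complex.Im (g x) = 0)].
Proof.
move=> [_ [C0 [gamma [m [delta [C00 gamma0 gE]]]]] gL1 gc].
have [Ir Ii] := complex_L1 gL1.
pose al := pi ^+ 2 / gamma.
have al0 : 0 < al by rewrite divr_gt0// exprn_gt0// pi_gt0.
have [Ig g0] := gauss_integral al0.
set I0 := (\int[mu]_x gauss al x)%R in g0.
pose A := C0 / I0; pose ds := [seq delta i | i <- enum 'I_m].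
pose v := exp_convs ds (fun x => A * gauss al x).
have IA : L1 (fun x => A * gauss al x) by exact: L1Z.
have bA : bounded_lip (fun x => A * gauss al x).
  by apply: bounded_lipZ; exact: bounded_lip_gauss.
have bv : bounded_lip v by exact: bounded_lip_exp_convs.
have Iv : L1 v by exact: L1_exp_convs.
have pi0 : pi != 0 :> R by rewrite gt_eqF// pi_gt0.
have TA w ph : trigT (fun x => A * gauss al x) w ph =
    cos ph * (C0 * expR (- (w ^+ 2 / (4 * al)))).
  rewrite /trigT; under eq_Rintegral do rewrite -mulrA.
  rewrite RintegralZl//; last exact: L1_trig.
  have := trigT_gauss ph al0 w; rewrite /trigT => ->.
  by rewrite /A -/I0; field.
have vE xi : trig_pair v (2 * pi * xi) = fourier g xi.
  rewrite gE trig_pair_exp_convs// /ds big_map big_enum /=; congr (_ * _).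
    rewrite /trig_pair !TA cosN cos_pihalf cos0 mul1r mul0r oppr0.
    rewrite (_ : (2 * pi * xi) ^+ 2 / (4 * al) = gamma * xi ^+ 2)//.
    by rewrite /al; move: (pi : R) pi0 => p p0; field; rewrite p0 gt_eqF.
  by apply: eq_bigr => nu _; congr (1 + 'i * _%:C)^-1; ring.
have parts w : [/\ trigT v w 0 = trigT (fun x => complex.Re (g x)) w 0 +
      trigT (fun x => complex.Im (g x)) w (- (pi / 2)) &
    - trigT v w (- (pi / 2)) = trigT (fun x => complex.Im (g x)) w 0 -
      trigT (fun x => complex.Re (g x)) w (- (pi / 2))].
  have wE : w = 2 * pi * (w / (2 * pi)) by move: (pi : R) pi0 => p p0; field.
  by have := vE (w / (2 * pi)); rewrite -wE (fourier_parts gL1 wE) => -[].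
have eqs w : [/\ trigT (fun x => complex.Re (g x)) w 0 = trigT v w 0,
    trigT (fun x => complex.Re (g x)) w (- (pi / 2)) = trigT v w (- (pi / 2)),
    trigT (fun x => complex.Im (g x)) w 0 = 0 &
    trigT (fun x => complex.Im (g x)) w (- (pi / 2)) = 0].
  have [p1 p2] := parts w; have [n1 n2] := parts (- w).
  have [v1 v2] := trigTN w Iv; have [r1 r2] := trigTN w Ir; have [i1 i2] := trigTN w Ii.
  rewrite v1 r1 i2 in n1; rewrite v2 r2 i1 in n2.
  by split; lra.
have T0 w ph : trigT (fun=> 0 : R) w ph = 0.
  by rewrite /trigT; under eq_Rintegral do rewrite mul0r; rewrite Rintegral_cst// mul0r.
have I00 : L1 (fun=> 0 : R).
  rewrite (_ : (fun=> 0) = (fun x => 0 * complex.Re (g x))); first exact: L1Z.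
  by apply/funext => x; rewrite mul0r.
exists al, A, ds; split=> //.
  have E : (fun x => complex.Re (g x)) = v.
    apply: trig_pair_unique => //; [exact: Re_continuous|exact: bounded_lip_continuous|].
    by move=> w; rewrite /trig_pair; have [-> -> _ _] := eqs w.
  by move=> x; exact: (congr1 (fun f => f x) E).
have E : (fun x => complex.Im (g x)) = fun=> 0.
  apply: trig_pair_unique => //; [exact: Im_continuous|by move=> ?; exact: cvg_cst|].
  by move=> w; rewrite /trig_pair !T0; have [_ _ -> ->] := eqs w.
by move=> x; exact: (congr1 (fun f => f x) E).
Qed.
End ComplexTools.

(** * From weak* to pointwise convergence *)

Section WeakStar.
Variable R : realType.
Notation mu := (@lebesgue_measure R).
Local Open Scope complex_scope.
Implicit Types (g f : R -> R[i]) (ds : seq R) (al A M a b x : R).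

Definition int_range (n : nat) : {fset int} :=
  [fset k in [seq Posz i | i <- iota 0 n] ++ [seq Negz i | i <- iota 0 n]]%fset.

Lemma big_int_range (V : nmodType) (F : int -> V) n :
  \sum_(k <- int_range n) F k = \sum_(0 <= i < n) (F (Posz i) + F (Negz i)).
Proof.
rewrite (perm_big ([seq Posz i | i <- iota 0 n] ++ [seq Negz i | i <- iota 0 n])).
  by rewrite big_cat !big_map big_split /index_iota subn0.
have iP : injective Posz by move=> ? ? [].
have iN : injective Negz by move=> ? ? [].
apply: uniq_perm => [||k]; first exact: fset_uniq; last first.
  by rewrite /int_range in_fset.
rewrite cat_uniq !map_inj_uniq// !iota_uniq/= andbT.
by apply/hasPn => _ /mapP[i _ ->]; apply/mapP => -[].
Qed.

(** Finite sets of integers are exhausted by the ranges -n, ..., n - 1, so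
    unconditional convergence may be tested along this sequence. *)
Lemma int_range_totally : int_range n @[n --> \oo] --> summability.totally.
Proof.
move=> P [/= D _ DP]; exists (\sum_(k <- D) `|k|.+1)%N => // n /= Dn.
apply: DP => /=; apply/fsubsetP => k kD.
have kn : (`|k| < n)%N.
  apply: leq_trans Dn; rewrite (big_fsetD1 k)//=; exact: leq_addr.
rewrite in_fset mem_cat; case: k kD kn => i _ /= kn; apply/orP; [left|right].
  by apply/map_f; rewrite mem_iota.
by apply/map_f; rewrite mem_iota /= add0n ltnW.
Qed.

Lemma L1_indicator a b : L1 (\1_`[a, b]%classic : R -> R).
Proof.
rewrite /L1 (_ : EFin \o _ = (EFin \o (fun=> 1 : R)) \_ `[a, b]%classic).
  apply/(integrable_mkcond _ _).1 => //.
  by apply: continuous_integrable_itv => ?; exact: cvg_cst.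
by apply/funext => x; rewrite /= patchE indicE; case: ifP.
Qed.

Lemma Rintegral_indicator a b (f : R -> R) :
  \int[mu]_x (f x * \1_`[a, b]%classic x) = \int[mu]_(x in `[a, b]) f x.
Proof.
rewrite [RHS]Rintegral_mkcond; apply: eq_Rintegral => x _.
by rewrite patchE indicE; case: ifP; rewrite ?mulr1 ?mulr0.
Qed.

Lemma eq_integrals_eq (u v : R -> R) : continuous u -> continuous v ->
  (forall a b, \int[mu]_(x in `[a, b]) u x = \int[mu]_(x in `[a, b]) v x) -> u = v.
Proof.
move=> cu cv uv; apply/funext => x.
have cint (w : R -> R) := @continuous_integrable_itv R w (x - 1) (x + 1).
have xx : x < x + 1 by rewrite ltrDl.
have x1 : x - 1 < x by rewrite gtrBl.
have [_ <-] := continuous_FTC1_closed xx (cint u cu) x1 (cu x).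
have [_ <-] := continuous_FTC1_closed xx (cint v cv) x1 (cv x).
by congr (derive1 _ x); apply/funext => y; exact: uv.
Qed.

Lemma complex_Lp1_indicator a b : complex_Lp 1%:E (fun x : R => (\1_`[a, b]%classic x : R)%:C).
Proof.
split => /=.
- exact: measurable_indic.
- exact: measurable_cst.
- rewrite /finite_norm Lnorm1.
  have /integrableP[_] := L1_indicator a b.
  apply: le_lt_trans; rewrite le_eqVlt; apply/orP; left; apply/eqP.
  apply: eq_integral => x _ /=.
  by rewrite expr0n addr0 sqrtr_sqr normr_id.
Qed.

Section identification.
Variables (g f : R -> R[i]) (al A : R) (ds : seq R).
Hypothesis al0 : 0 < al.
Hypothesis gRe : forall x, complex.Re (g x) = exp_convs ds (fun x => A * gauss al x) x.
Hypothesis gIm : forall x, complex.Im (g x) = 0.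

(** The partial sums converge pointwise and boundedly to an iterated convolution
    w of a lattice sum of Gaussians.  Against the indicator of an interval they
    converge to the integral of w by dominated convergence, and to the integral of
    Re f by hypothesis; hence Re f and w have the same integrals over all
    intervals. *)
Lemma shift_invariant_lattice_cvg : shift_invariant_Loo g f ->
  exists (c : int -> R) (M : R), (forall k, `|c k| <= M) /\
  forall x, lattice_partial c (exp_convs ds (gauss al)) n x @[n --> \oo] --> complex.Re (f x).
Proof.
move=> [fc _ [c [[M cM] cf]]].
have bg := bounded_lip_gauss al0.
pose c' k := A * complex.Re (c k).
have c'M k : `|c' k| <= `|A| * M.
  by rewrite normrM ler_wpM2l// (le_trans (normc_Re _)).
exists c', (`|A| * M); split=> //.
have [B hB] := exp_convs_lattice_bounded ds al0 c'M.
pose h := exp_convs ds (gauss al); pose w := exp_convs ds (lattice_sum c' (gauss al)).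
have bh : bounded_lip h by exact: bounded_lip_exp_convs.
have bw : bounded_lip w by apply: bounded_lip_exp_convs; exact: bounded_lip_lattice_gauss c'M.
have hw x := @exp_convs_lattice_cvg R ds al c' _ x al0 c'M.
suff E : (fun x => complex.Re (f x)) = w.
  by move=> x; have := hw x; rewrite -/w -(congr1 (fun u => u x) E).
apply: eq_integrals_eq; [exact: Re_continuous|exact: bounded_lip_continuous|] => a b.
pose ind : R -> R := \1_`[a, b]%classic.
have ind1 x : `|ind x| <= 1.
  by rewrite /ind indicE; case: (_ \in _); rewrite ?normr1 ?normr0.
have mind : measurable_fun setT ind by exact: measurable_indic.
have partialE n x : complex.Re (\sum_(k <- int_range n) c k * g (x - k%:~R)) =
    lattice_partial c' h n x.
  have ReD : {morph (@complex.Re R) : y z / y + z >-> y + z} by move=> [? ?] [? ?].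
  rewrite (big_morph _ ReD (erefl : complex.Re (0 : R[i]) = 0)) big_int_range.
  apply: eq_bigr => i _.
  have E k : complex.Re (c k * g (x - k%:~R)) = c' k * h (x - k%:~R).
    have := gRe (x - k%:~R); have := gIm (x - k%:~R).
    rewrite exp_convs_scale//; case: (g _) => g1 g2 /= -> ->.
    rewrite /c' /h; case: (c k) => c1 c2 /=; ring.
  by rewrite !E.
have limw : \int[mu]_x (lattice_partial c' h n x * ind x) @[n --> \oo] -->
    \int[mu]_x (w x * ind x).
  apply: (@Rintegral_dominated_cvg _ _ _ (fun x => B * `|ind x|) _ _ _ _).2 => [n||n x|x].
  - apply: measurable_funM => //; apply: bounded_lip_measurable.
    exact: bounded_lip_lattice_partial.
  - by apply: L1Z; apply: L1_norm; exact: L1_indicator.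
  - by rewrite normrM ler_wpM2r.
  - by apply: cvgM; [exact: hw|exact: cvg_cst].
have limf : \int[mu]_x (lattice_partial c' h n x * ind x) @[n --> \oo] -->
    \int[mu]_x (complex.Re (f x) * ind x).
  have := cvg_comp _ _ int_range_totally (cf _ (complex_Lp1_indicator a b)).
  move=> /Re_cvg; rewrite /complex_integral/=.
  set l1 := Rintegral _ _ _; set l2 := (X in _ -> _ --> X).
  have -> : l1 = l2.
    by apply: eq_Rintegral => x _; case: (f x) => ? ? /=; rewrite mulr0 subr0.
  apply: cvg_trans; apply: near_eq_cvg; near=> n.
  apply: eq_Rintegral => x _ /=; rewrite -partialE.
  by case: (\sum_(k <- _) _) => ? ? /=; rewrite mulr0 subr0.
rewrite -!Rintegral_indicator; exact: cvg_unique limf limw.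
Unshelve. all: by end_near. Qed.
End identification.
End WeakStar.

(** * Counting zeros *)

Section Counting.
Variable R : realType.
Implicit Types (L : set R) (u v : R -> R) (d r x y : R) (ds : seq R).

Definition many_zeros u r n := exists s : seq R,
  [/\ uniq s, size s = n & forall x, x \in s -> `|x| <= r /\ u x = 0].

Lemma many_zeros_le u r n m : (m <= n)%N -> many_zeros u r n -> many_zeros u r m.
Proof.
move=> mn [s [us sn sP]]; exists (take m s); split.
- exact: take_uniq.
- by rewrite size_takel// sn.
- by move=> x /mem_take; exact: sP.
Qed.

(** One zero in each gap between consecutive zeros, in increasing order. *)
Lemma rolle_chain d u x s : bounded_lip u -> d != 0 -> path <%R x s ->
  (forall y, y \in x :: s -> exp_conv d u y = 0) ->
  exists zs, [/\ size zs = size s, path <%R x zs,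
    forall z, z \in zs -> z <= last x s & forall z, z \in zs -> u z = 0].
Proof.
move=> bu d0; elim: s x => [|y s IH] x /=; first by exists [::].
move=> /andP[xy ys] H.
have [|zs [sz pz lz uz]] := IH y ys.
  by move=> z zys; apply: H; rewrite inE zys orbT.
have yH : y \in [:: x, y & s] by rewrite !inE eqxx orbT.
have [z /andP[xz zy] uz0] := exp_conv_rolle bu d0 xy (H x (mem_head _ _)) (H y yH).
have yl : y <= last y s.
  have /allP := lt_path_min ys.
  by case: (s) => //= t s' h; apply: ltW; apply: h; exact: mem_last.
exists (z :: zs); split => /=; first by rewrite sz.
- rewrite xz/=; case: (zs) pz => //= t zs' /andP[yt ->].
  by rewrite (lt_trans zy yt).
- by move=> t; rewrite inE => /predU1P[->|/lz//]; rewrite (le_trans (ltW zy)).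
- by move=> t; rewrite inE => /predU1P[->|/uz].
Qed.

Lemma exp_conv_many_zeros d u r n : bounded_lip u ->
  many_zeros (exp_conv d u) r n -> many_zeros u r n.-1.
Proof.
move=> bu; have [->|d0] := eqVneq d 0.
  by rewrite exp_conv0; apply: many_zeros_le; exact: leq_pred.
case: n => [_|n]; first by exists [::].
move=> [s [us sn sP]].
have ss : sorted <%R (sort <=%R s) by rewrite lt_sorted_uniq_le sort_uniq us sort_le_sorted.
have szs : size (sort <=%R s) = n.+1 by rewrite size_sort.
have mem z : (z \in sort <=%R s) = (z \in s) by rewrite mem_sort.
move: ss szs mem; case: (sort _ _) => // x t /= pt [tn] mem.
have [y ys|zs [szz pz lz uz]] := @rolle_chain d u x t bu d0 pt.
  by have [] := sP y; rewrite -?mem.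
exists zs; split; [|by rewrite szz|].
  by have := pz => /path_sorted; rewrite lt_sorted_uniq_le => /andP[].
move=> z zzs; split; last exact: uz.
have [xr _] := sP x (etrans (esym (mem x)) (mem_head _ _)).
have [lr _] := sP (last x t) (etrans (esym (mem _)) (mem_last _ _)).
have xz : x < z by have /allP/(_ _ zzs) := lt_path_min pz.
by move: xr lr (lz _ zzs); rewrite !ler_norml; lra.
Qed.

(** Each convolution costs at most one zero. *)
Lemma exp_convs_many_zeros ds u r n : bounded_lip u ->
  many_zeros (exp_convs ds u) r n -> many_zeros u r (n - size ds).
Proof.
move=> bu; elim: ds n => [|d ds IH] n /=; first by rewrite subn0.
move=> h; rewrite -add1n subnDA subn1; apply: IH; apply: exp_conv_many_zeros h.
exact: bounded_lip_exp_convs.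
Qed.

Lemma bounded_size_exhausted (P : R -> Prop) N :
  (forall s : seq R, uniq s -> (forall x, x \in s -> P x) -> (size s <= N)%N) ->
  exists s, uniq s /\ forall x, x \in s <-> P x.
Proof.
move=> H; pose Q n := `[< exists s : seq R, [/\ uniq s, size s = n & forall x, x \in s -> P x] >].
have Q0 : exists n, Q n by exists 0%N; apply/asboolP; exists [::].
have QN n : Q n -> (n <= N)%N by move=> /asboolP[s [us <- sP]]; exact: H.
have [n /asboolP[s [us sn sP]] nmax] := ex_maxnP Q0 QN.
exists s; split=> // x; split=> [|Px]; first exact: sP.
apply: contrapT => /negP xs.
have /nmax : Q n.+1.
  apply/asboolP; exists (x :: s); split; [by rewrite /= xs|by rewrite /= sn|].
  by move=> y; rewrite inE => /predU1P[->//|]; exact: sP.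
by rewrite ltnn.
Qed.

(** Only the intervals centred at 0 are kept from the lower density. *)
Lemma lower_density_points L : (2%:E < lower_beurling_density L)%E ->
  exists d r0 : R, 2 < d /\ forall r, r0 < r -> 0 < r -> exists s : seq R,
    [/\ uniq s, forall x, x \in s -> L x /\ `|x| <= r & d * (2 * r) <= (size s)%:R].
Proof.
rewrite /lower_beurling_density limf_einfE => /ereal_sup_gt[y [V [M [_ MV]] <-]] dy.
have [d d2 dle] : exists2 d : R, 2 < d & (d%:E <= ereal_inf [set (ereal_inf (range (fun x : R =>
   (counting (L `&` `[(x - r)%R, (x + r)%R]) * (2 * r)^-1%:E)%E))) | r in V])%E.
  move: dy; case: (ereal_inf _) => [t| |]//=.
  - by rewrite lte_fin => t2; exists t.
  - by move=> _; exists 3; rewrite ?ltr_nat// leey.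
exists d, M; split=> // r Mr r0.
have /(le_trans dle) h1 : (ereal_inf [set (ereal_inf (range (fun x : R =>
   (counting (L `&` `[(x - r)%R, (x + r)%R]) * (2 * r)^-1%:E)%E))) | r in V] <=
   ereal_inf (range (fun x : R => (counting (L `&` `[(x - r)%R, (x + r)%R]) * (2 * r)^-1%:E)%E)))%E.
  by apply: ereal_inf_lbound; exists r => //; exact: MV.
have {h1} : (d%:E <= counting (L `&` `[(0 - r)%R, (0 + r)%R]) * (2 * r)^-1%:E)%E.
  by apply: le_trans h1 _; apply: ereal_inf_lbound; exists 0.
set A := L `&` _.
have AP x : A x -> L x /\ `|x| <= r.
  by move=> [Lx]; rewrite /= in_itv/= sub0r add0r -ler_norml.
rewrite /counting; case: asboolP => [fA|iA].
  rewrite -EFinM lee_fin ler_pdivlMr ?mulr_gt0// => h.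
  exists (fset_set A); split => //; first exact: fset_uniq.
  by move=> x; rewrite in_fset_set// => /set_mem/AP.
move=> _; have [B BA Bn] := infinite_set_fset (Num.truncn (d * (2 * r))).+1 iA.
exists B; split; [exact: fset_uniq|by move=> x xB; apply: AP; exact: BA|].
apply: le_trans (ltW (truncnS_gt _)) _.
by rewrite ler_nat.
Qed.

(** There are at most N - |l| integers j < N with |l| <= j. *)
Lemma sum_indicator_le (l : R) N : `|l| <= N%:R ->
  \sum_(0 <= j < N) ((`|l| <= j%:R)%R)%:R <= N%:R - `|l| :> R.
Proof.
elim: N => [|N IH] lN.
  by rewrite big_nil subr_ge0.
have [lN'|lN'] := leP `|l| N%:R.
  rewrite big_nat_recr//= lN' -natr1 addrAC lerD2r; exact: IH.
rewrite big_nat_cond big1 ?subr_ge0// => j /andP[/andP[_ jN] _].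
case: leP => // lj; move: (lt_le_trans lN' lj); rewrite ltr_nat ltnNge.
by rewrite -ltnS jN.
Qed.

Lemma sum_count_le (ls : seq R) N : (forall l, l \in ls -> `|l| <= N%:R) ->
  (\sum_(0 <= j < N) (count (fun l => (`|l| <= j%:R)%R) ls)%:R <=
   \sum_(l <- ls) (N%:R - `|l|) :> R)%R.
Proof.
move=> lsN; under eq_bigr do rewrite -sum1_count natr_sum big_mkcond/=.
rewrite exchange_big/= big_seq [leRHS]big_seq; apply: ler_sum => l lls.
apply: le_trans (sum_indicator_le (lsN l lls)).
by apply: ler_sum => j _; case: ifP.
Qed.

(** A discrete form of gauss_zeros_sum, with cnt j the number of zeros in [-j, j].
    That inequality, for a slightly larger radius, also bounds the number of zeros
    in [-N, N], so that they form a finite set. *)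
Lemma lattice_gauss_zero_count al c M : 0 < al -> (forall k, `|c k| <= M) ->
  (exists j, c j != 0) -> exists C D : R, forall N : nat,
  exists cnt : nat -> nat,
    (forall j n, (j <= N)%N -> many_zeros (lattice_sum c (gauss al)) j%:R n -> (n <= cnt j)%N) /\
    \sum_(0 <= j < N) (cnt j)%:R <= (N%:R + C) ^+ 2 + D.
Proof.
move=> al0 cM c0; have [C [D H]] := gauss_zeros_sum al0 cM c0.
exists C, D => N.
pose P x := `|x| <= N%:R /\ lattice_sum c (gauss al) x = 0.
have [s [us sP]] : exists s, uniq s /\ forall x, x \in s <-> P x.
  apply: (@bounded_size_exhausted P (Num.truncn ((N.+1%:R + C) ^+ 2 + D))) => s us sP.
  rewrite truncn_ge_nat; last first.
    apply: le_trans (H N.+1%:R [::] _ _ _) => //; by rewrite big_nil.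
  apply: le_trans (H N.+1%:R s _ us _) => //; last first.
    move=> l /sP[lN l0]; split=> //; apply: (le_trans lN); by rewrite ler_nat.
  rewrite -sum1_size natr_sum big_seq [leRHS]big_seq; apply: ler_sum => l /sP[lN _].
  by rewrite -natr1; lra.
exists (fun j => count (fun l => `|l| <= j%:R) s); split.
  move=> j n jN [t [ut <- tP]]; rewrite -size_filter; apply: uniq_leq_size => // l /tP[lj l0].
  by rewrite mem_filter lj; apply/sP; split=> //; rewrite (le_trans lj)// ler_nat.
apply: le_trans (H N%:R s _ us _) => //; last by move=> l /sP.
by apply: sum_count_le => l /sP[].
Qed.

Lemma quadratic_contradiction (e a b : R) : 0 < e ->
  (forall N : nat, e * N%:R ^+ 2 <= a * N%:R + b) -> False.
Proof.
move=> e0 H; pose t := (`|a| + `|b|) / e.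
pose N := (Num.truncn t).+1.
have tN : t < N%:R by exact: truncnS_gt.
have N1 : 1 <= N%:R :> R by rewrite ler1n.
have : `|a| + `|b| < e * N%:R by rewrite mulrC -ltr_pdivrMr.
have := H N; have := ler_norm a; have := ler_norm b.
have := normr_ge0 a; have := normr_ge0 b; move: `|a| `|b| => A B; nra.
Qed.

End Counting.

(** * Sign retrieval *)

Section Final.
Variable R : realType.
Local Open Scope complex_scope.

Lemma real_Im0 (z : R[i]) : z \is Num.real -> complex.Im z = 0.
Proof. by case: z => a b; rewrite realE !lecE /= => /orP[] /andP[/eqP]. Qed.

Lemma real_norm_eq (y z : R[i]) : y \is Num.real -> z \is Num.real -> `|y| = `|z| ->
  complex.Re y = complex.Re z \/ complex.Re y = - complex.Re z.
Proof.
move=> /real_Im0 + /real_Im0; case: y z => a b [c d] /= -> ->.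
rewrite !normc_def /= => -[]; rewrite expr0n !addr0 !sqrtr_sqr => /eqP.
by rewrite eqr_norm2 => /orP[]/eqP ->; [left|right].
Qed.

(** The zeros in [-j, j] of the two Gaussian lattice sums number at least 2 d j up
    to a constant, with d > 2.  Summing over j < N gives d N^2 - O(N), whereas
    lattice_gauss_zero_count allows only 2 N^2 + O(N). *)
Lemma union_zeros_bound (u v : R -> R) (L : set R) al c1 c2 M1 M2 ds :
  0 < al -> (forall k, `|c1 k| <= M1) -> (forall k, `|c2 k| <= M2) ->
  (exists j, c1 j != 0) -> (exists j, c2 j != 0) ->
  u = exp_convs ds (lattice_sum c1 (gauss al)) -> v = exp_convs ds (lattice_sum c2 (gauss al)) ->
  (2%:E < lower_beurling_density L)%E -> ~ (forall x, L x -> u x = 0 \/ v x = 0).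
Proof.
move=> al0 cM1 cM2 c10 c20 uE vE dL H.
have [C1 [D1 Z1]] := lattice_gauss_zero_count al0 cM1 c10.
have [C2 [D2 Z2]] := lattice_gauss_zero_count al0 cM2 c20.
have [d [r0 [d2 Ld]]] := lower_density_points dL.
pose m := size ds; pose E : R := 2 * m%:R + 2 * d * Num.max r0 0.
have r00 : 0 <= Num.max r0 0 by rewrite le_max lexx orbT.
have d0 : 0 < d by rewrite (lt_trans _ d2).
apply: (@quadratic_contradiction R (d - 2) (d + E + 2 * C1 + 2 * C2) (C1 ^+ 2 + D1 + C2 ^+ 2 + D2)).
  by rewrite subr_gt0.
move=> N; have [n1 [cnt1 sum1]] := Z1 N; have [n2 [cnt2 sum2]] := Z2 N.
have low j : (j <= N)%N -> 2 * d * j%:R - E <= (n1 j)%:R + (n2 j)%:R.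
  move=> jN; have [jr|rj] := leP j%:R (Num.max r0 0).
    have : 2 * d * j%:R <= 2 * d * Num.max r0 0 by rewrite ler_wpM2l// mulr_ge0// ltW.
    have := ler0n R (n1 j); have := ler0n R (n2 j); have := ler0n R m.
    by rewrite /E; lra.
  have [r0j j0] : r0 < j%:R /\ 0 < j%:R :> R.
    by move: rj; rewrite gt_max => /andP[].
  have [s [us sL sn]] := Ld _ r0j j0.
  pose p x := `[< u x = 0 >].
  pose su := [seq x <- s | p x]; pose sv := [seq x <- s | ~~ p x].
  have s1 : (size su - m <= n1 j)%N.
    apply: cnt1 => //; apply: (@exp_convs_many_zeros _ ds).
      exact: bounded_lip_lattice_gauss cM1.
    exists su; split; [exact: filter_uniq|by []|move=> x].
    by rewrite mem_filter -uE => /andP[/asboolP ux /sL[]].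
  have s2 : (size sv - m <= n2 j)%N.
    apply: cnt2 => //; apply: (@exp_convs_many_zeros _ ds).
      exact: bounded_lip_lattice_gauss cM2.
    exists sv; split; [exact: filter_uniq|by []|move=> x].
    by rewrite mem_filter -vE => /andP[/asboolP ux /sL[/H[]]].
  have ss : (size s <= n1 j + n2 j + (m + m))%N.
    rewrite -(count_predC p s) -!size_filter addnACA leq_add//.
      by rewrite addnC -leq_subLR.
    by rewrite addnC -leq_subLR.
  have : (size s)%:R <= (n1 j + n2 j + (m + m))%:R :> R by rewrite ler_nat.
  have : 0 <= 2 * d * Num.max r0 0 by rewrite mulr_ge0// mulr_ge0// ltW.
  by rewrite !natrD /E; move: sn; lra.
have : \sum_(0 <= j < N) (2 * d * j%:R - E) <=
    \sum_(0 <= j < N) ((n1 j)%:R + (n2 j)%:R).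
  by rewrite big_nat [leRHS]big_nat; apply: ler_sum => j /andP[_ /ltnW]; exact: low.
rewrite [leRHS]big_split/=.
have -> : \sum_(0 <= j < N) (2 * d * j%:R - E) = d * N%:R ^+ 2 - d * N%:R - E * N%:R.
  elim: (N) => [|k IH]; first by rewrite big_nil; ring.
  by rewrite big_nat_recr//= IH -natr1; ring.
by move: sum1 sum2; rewrite !expr2; lra.
Qed.

Lemma lattice_partial_const0 (c : int -> R) h n x : (forall k, c k = 0) ->
  lattice_partial c h n x = 0.
Proof.
by move=> c0; rewrite /lattice_partial /bipartial /series/= big1// => i _; rewrite !c0 !mul0r addr0.
Qed.

Lemma lattice_partial_comb (c1 c2 : int -> R) r h n x :
  lattice_partial (fun k => c1 k + r * c2 k) h n x =
  lattice_partial c1 h n x + r * lattice_partial c2 h n x.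
Proof.
rewrite /lattice_partial /bipartial /series/= mulr_sumr -big_split/=.
by apply: eq_bigr => i _; ring.
Qed.

End Final.

Theorem theorem1 (R : realType) (g : R -> R[i]) (L : set R)
    (f1 f2 : R -> R[i]) :
  gaussian_type_tp g ->
  (2%:E < lower_beurling_density L)%E ->
  shift_invariant_Loo g f1 ->
  shift_invariant_Loo g f2 ->
  (forall x : R, f1 x \is Num.real) ->
  (forall x : R, f2 x \is Num.real) ->
  (forall lambda : R, L lambda -> `|f1 lambda| = `|f2 lambda|) ->
  (forall x : R, f1 x = f2 x) \/ (forall x : R, f1 x = - f2 x).
Proof.
move=> tpg dL f1V f2V f1r f2r f12.
have [al [A [ds [al0 gRe gIm]]]] := gaussian_type_tp_exp_convs tpg.
have [c1 [M1 [cM1 lim1]]] := shift_invariant_lattice_cvg al0 gRe gIm f1V.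
have [c2 [M2 [cM2 lim2]]] := shift_invariant_lattice_cvg al0 gRe gIm f2V.
pose c r k : R := c1 k + r * c2 k.
have cM r k : `|c r k| <= M1 + `|r| * M2.
  by rewrite (le_trans (ler_normD _ _))// lerD// normrM ler_wpM2l.
have limc r x : lattice_partial (c r) (exp_convs ds (gauss al)) n x @[n --> \oo] -->
    complex.Re (f1 x) + r * complex.Re (f2 x).
  under eq_fun do rewrite lattice_partial_comb.
  by apply: cvgD => //; apply: cvgM => //; exact: cvg_cst.
have combE r : (fun x => complex.Re (f1 x) + r * complex.Re (f2 x)) =
    exp_convs ds (lattice_sum (c r) (gauss al)).
  apply/funext => x; apply: (cvg_unique _ (limc r x)) => //.
  exact: exp_convs_lattice_cvg (cM r).
have vanish r : ~ (exists k, c r k != 0) ->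
    forall x, complex.Re (f1 x) + r * complex.Re (f2 x) = 0.
  move=> h x; have c0 k : c r k = 0.
    by apply/eqP; apply: contrapT => /negP ck; apply: h; exists k.
  apply: (cvg_unique _ (limc r x)) => //.
  rewrite (_ : (fun n => _) = fun=> 0); first exact: cvg_cst.
  by apply/funext => n; exact: lattice_partial_const0.
have reE x y : complex.Re (f1 x) = y -> f1 x = (y +i* 0)%C.
  by have := real_Im0 (f1r x); case: (f1 x) => a b /= -> ->.
have f2E x : f2 x = (complex.Re (f2 x) +i* 0)%C.
  by have := real_Im0 (f2r x); case: (f2 x) => a b /= ->.
have [h1|/vanish h1] := pselect (exists k, c 1 k != 0); last first.
  right=> x; rewrite (reE x (- complex.Re (f2 x))).
    by rewrite [in RHS]f2E; apply/eqP; rewrite eq_complex/= oppr0 !eqxx.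
  by have := h1 x; lra.
have [h2|/vanish h2] := pselect (exists k, c (-1) k != 0); last first.
  left=> x; rewrite (reE x (complex.Re (f2 x)))//.
  by have := h2 x; lra.
exfalso; apply: (union_zeros_bound al0 (cM 1) (cM (-1)) h1 h2 (combE 1) (combE (-1)) dL).
move=> x Lx; have [E|E] := real_norm_eq (f1r x) (f2r x) (f12 x Lx).
  by right; rewrite E; lra.
by left; rewrite E; lra.
Qed.
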